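(* Let $T=(T_1,\dots,T_n)$ be an $n$-tuple of (not necessarily commuting) bounded operators on a Hilbert space with $\mathbb{W}(T)\subseteq\overline{\mathbb{B}}$. Then, for any polynomial $p$ in $n$ variables, scalar or (square) matrix valued, $$\|p_s(T)\|\le\|\Gamma p\|_{\overline{\mathbb{B}}}.$$
   Context: $\mathbb{B}$ is the open unit ball of $\mathbb{C}^n$ and $\overline{\mathbb{D}}$ the closed unit disk. For an operator $R$, $W(R)=\{\langle R\xi,\xi\rangle:\|\xi\|=1\}$ is its numerical range. The condition $\mathbb{W}(T)\subseteq\overline{\mathbb{B}}$ means that $W(\bar u_1T_1+\dots+\bar u_nT_n)\subseteq\overline{\mathbb{D}}$ for every $u\in\overline{\mathbb{B}}$. Symmetrized functional calculus: $(z^\alpha)_s(T)=\frac{\alpha!}{|\alpha|!}\sum T_{i_1}T_{i_2}\cdots T_{i_{|\alpha|}}$, the sum being over all distinct arrangements $(i_1,\dots,i_{|\alpha|})$ of $\alpha_1$ 1's, $\alpha_2$ 2's, ..., $\alpha_n$ $n$'s; $p\mapsto p_s(T)$ is extended linearly to scalar polynomials, and for a $d\times d$ matrix-valued polynomial $p=(p_{ij})$, $p_s(T)$ is the operator matrix $([p_{ij}]_s(T))$. $\Gamma p=2(n-1)!\,E_z[p-p(0)]+p(0)$, where $E_z=\frac{1}{(n-1)!}\prod_{j=1}^{n-1}\left(j+\sum_{i=1}^nz_i\frac{\partial}{\partial z_i}\right)$; $\Gamma$ is applied entrywise to matrix-valued polynomials. $\|q\|_{\overline{\mathbb{B}}}=\sup_{z\in\overline{\mathbb{B}}}\|q(z)\|$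 (operator norm for matrices). *)

(* Defs.v *)
From HB Require Import structures.
From mathcomp Require Import all_boot all_order all_algebra.
From mathcomp Require Import sesquilinear complex.
(* The notations of mpoly clash with those of MathComp-Analysis. *)
From mathcomp Require Import -(notations) mpoly.
From mathcomp Require Import all_classical all_reals all_analysis.

Set Implicit Arguments.
Unset Strict Implicit.
Unset Printing Implicit Defensive.

Import Order.TTheory GRing.Theory Num.Theory.
Import numFieldNormedType.Exports.

Local Open Scope classical_set_scope.
Local Open Scope ring_scope.

Section Norms.
Variable R : realType.

(* The norm `|x| is an element of R[i], of imaginary part 0. *)
Definition rnorm (V : normedZmodType R[i]) (x : V) : R := complex.Re `|x|.

(* The l2 norm on V^d, which is not the library's norm on matrices (the maximum
   of the norms of the entries). *)
Definition l2norm (V : normedZmodType R[i]) d (x : 'cV[V]_d) : R :=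
  Num.sqrt (\sum_(i < d) rnorm (x i 0) ^+ 2).

Definition closed_unit_ball n : set 'cV[R[i]]_n := [set z | l2norm z <= 1].

(* The norm of the operator A on the space V with norm N: the supremum is taken
   in \bar R, so that it is +oo when A is unbounded. *)
Definition opnorm (V : Type) (N : V -> R) (A : V -> V) : \bar R :=
  ereal_sup [set (N (A x))%:E | x in [set x | N x <= 1]].

End Norms.

Section NumericalRange.
Variables (R : realType) (H : normedModType R[i]).
Variable ip : {dot H for Num.conj}.

Definition numerical_range (A : H -> H) : set R[i] :=
  [set ip (A xi) xi | xi in [set xi : H | `|xi| = 1]].

Definition joint_numerical_range_in_ball n (T : 'I_n -> {linear H -> H}) :=
  forall u : 'cV[R[i]]_n, closed_unit_ball u ->
    numerical_range (fun x => \sum_(i < n) (u i 0)^* *: T i x)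
      `<=` [set z | `|z| <= 1].

End NumericalRange.

Section SymmetrizedCalculus.
Variables (C : fieldType) (H : lmodType C) (n : nat).
Variable T : 'I_n -> {linear H -> H}.

(* T_{i_1} T_{i_2} ... T_{i_k} x for w = (i_1, ..., i_k) *)
Definition word_op (w : seq 'I_n) (x : H) : H := foldr (fun i y => T i y) x w.

Definition is_arrangement (m : multinom n) (w : seq 'I_n) : bool :=
  [forall i, count_mem i w == m i].

Definition sym_monomial (m : multinom n) (x : H) : H :=
  ((\prod_(i < n) (m i)`!)%:R / ((mdeg m)`!)%:R) *:
  \sum_(w : (mdeg m).-tuple 'I_n | is_arrangement m w) word_op w x.

Definition sym_calc (p : mpoly n C) (x : H) : H :=
  \sum_(m <- msupp p) mcoeff m p *: sym_monomial m x.

Definition sym_calc_mx d (P : 'M[mpoly n C]_d) (x : 'cV[H]_d) : 'cV[H]_d :=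
  \col_i \sum_(j < d) sym_calc (P i j) (x j 0).

End SymmetrizedCalculus.

Section Gamma.
Variables (C : fieldType) (n : nat).
Implicit Types p q : mpoly n C.

Definition euler q : mpoly n C :=
  \sum_(i < n) mpolyX C (mnm1 i) * mderiv i q.

Definition Ez q : mpoly n C :=
  ((n.-1)`!)%:R^-1 *:
  (\big[(fun f g => f \o g)/idfun]_(1 <= j < n) (fun r => j%:R *: r + euler r)) q.

Definition const_part p : mpoly n C :=
  mpolyC n (meval (fun=> 0) p).

Definition Gamma p : mpoly n C :=
  (2 * ((n.-1)`!)%:R) *: Ez (p - const_part p) + const_part p.

End Gamma.

Section SupNorm.
Variables (R : realType) (n : nat).

Definition supnorm (q : mpoly n R[i]) : \bar R :=
  ereal_sup [set (rnorm (meval (fun i => z i 0) q))%:E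
            | z in @closed_unit_ball R n].

Definition supnorm_mx d (Q : 'M[mpoly n R[i]]_d) : \bar R :=
  ereal_sup [set opnorm (@l2norm R R[i] d)
                   (mulmx (map_mx (meval (fun i => z i 0)) Q))
            | z in @closed_unit_ball R n].

End SupNorm.

(* Main.v *)
Require Import Defs.
From HB Require Import structures.
From mathcomp Require Import all_boot all_order all_algebra.
From mathcomp Require Import sesquilinear complex.
From mathcomp Require Import -(notations) mpoly.
From mathcomp Require Import all_classical all_reals all_analysis.
From mathcomp Require Import spectral cyclic separable cyclotomic.
From mathcomp Require Import ring zify.

Set Implicit Arguments.
Unset Strict Implicit.
Unset Printing Implicit Defensive.

Import Order.TTheory GRing.Theory Num.Theory.
Import numFieldNormedType.Exports.

Local Open Scope classical_set_scope.
Local Open Scope ring_scope.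

(** Why the inequality holds.  Let Q = 2 E_z[P - P(0)] + P(0), with homogeneous
    parts Q_k, and for a unit vector z of C^n let
    A_z = conj(z_1) T_1 + ... + conj(z_n) T_n, which has numerical radius at
    most 1.  Its powers are
      A_z^k = sum over |a| = k of (k!/a!) conj(z)^a (z^a)_s(T).
    On the unit sphere distinct monomials are orthogonal and the mean of
    |z^a|^2 is a! (n-1)! / (n-1+|a|)!; the multiplier E_z is the one that
    cancels these moments, so that P_s(T) is the mean over the sphere of
      Q_0 + (1/2) sum over k >= 1 of Q_k(z) A_z^k,
    where Q_k(z) A_z^k stands for a tensor product
    ([has_sphere_mean_symbol_form]).  It is therefore enough to bound this
    operator for each z, and since only the polynomial s |-> Q(s z) and the
    operator A_z occur in it, this is a statement about one variable.

    The case of one variable ([caratheodory_form_le]).  For w(A) <= 1, r < 1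
    and |s| = 1 the operator K(s) = Re (1 - r conj(s) A)^-1 is positive, its
    mean over the circle is 1, and its moments are the (1/2) r^k A^k.  Hence
    the operator to bound is, in the limit r -> 1, the mean of Q(s) K(s), and
    averaging a matrix symbol of norm at most c against a positive
    operator-valued kernel of mean 1 gives an operator of norm at most c
    ([sip_contraction], [sip_young]).  Inverses and integrals are avoided as
    follows.  The resolvent is truncated to y = sum over k < N of
    (r conj(s) A)^k x, for which (1 - r conj(s) A) y = x - (r conj(s) A)^N x,
    and <K(s) x, x> is replaced by Re <(1 - r conj(s) A) y, y>, which is again
    nonnegative; it is a trigonometric polynomial in s, so that its mean over the
    circle is a mean over roots of unity of high order.  The truncation leaves
    an error term built from (r A)^N x and (r A)^(N-k) z, which tends to 0
    because the same positivity gives (1 - r) |(r A)^k x|^2 <= |x|^2 for all r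
    ([dnorm_iter_le]).

    The mean over the sphere is likewise a limit of finite means
    ([has_sphere_mean_le]): the squared moduli of the coordinates run over the
    points of the simplex with denominator N, and the arguments over roots of
    unity.  The former have explicit moments up to O(1/N), since the falling
    factorial moments of the compositions of N are binomial coefficients
    ([simplex_mean_monomial]).

    Finally, Gamma carries a factor (n-1)! that Q does not have, but with
    l = 1/(n-1)! one has Q(z) = l (Gamma P)(z) + (1 - l) (Gamma P)(0), a convex
    combination of values of Gamma P on the ball ([sum_symbol_part]). *)

(** * Matrices acting on a semi-inner product space *)

Section SemiInnerProduct.
Local Open Scope sesquilinear_scope.
Variables (C : numClosedFieldType) (H : lmodType C).

Definition semi_inner_product (B : H -> H -> C) :=
  [/\ forall w, linear_for *%R (B^~ w), forall u v, B u v = (B v u)^*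
    & forall u, 0 <= B u u].

Variables (B : H -> H -> C).
Hypothesis Bsip : semi_inner_product B.

Lemma sip_suml (I : Type) (r : seq I) (P : pred I) (a : I -> C) (u : I -> H) w :
  B (\sum_(i <- r | P i) a i *: u i) w = \sum_(i <- r | P i) a i * B (u i) w.
Proof.
have [Bl _ _] := Bsip.
have B0 : B 0 w = 0.
  by have := Bl w (-1) 0 0; rewrite scaler0 addr0 mulN1r addNr.
elim/big_rec2: _ => [//|i y1 y2 _ <-]; exact: Bl.
Qed.

Lemma sip_sumr (I : Type) (r : seq I) (P : pred I) (a : I -> C) (u : I -> H) w :
  B w (\sum_(i <- r | P i) a i *: u i) = \sum_(i <- r | P i) (a i)^* * B w (u i).
Proof.
have [_ Bh _] := Bsip.
rewrite Bh sip_suml rmorph_sum; apply: eq_bigr => i _.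
by rewrite rmorphM /= -Bh.
Qed.

(** A matrix acts on tuples of vectors with at most its norm as an operator on
    C^d: the difference of the two sides is the value on x of c - Q^*Q, and the
    spectral theorem writes this positive matrix as a sum of squares, each of
    which contributes a nonnegative multiple of some B u u. *)
Lemma sip_contraction d (Q : 'M[C]_d) (c : C) (x : 'I_d -> H) :
  0 <= c ->
  (forall v : 'cV[C]_d,
     \sum_i `|(Q *m v) i 0| ^+ 2 <= c * \sum_i `|v i 0| ^+ 2) ->
  let y i := \sum_j Q i j *: x j in
  \sum_i B (y i) (y i) <= c * \sum_i B (x i) (x i).
Proof.
move=> c0 Qc; set y := fun i => \sum_j Q i j *: x j; rewrite /=; have [_ _ Bpos] := Bsip.
pose G : 'M[C]_d := c%:M - Q ^t* *m Q.
have GE l j : G l j = c *+ (l == j) - \sum_i (Q i l)^* * Q i j.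
  rewrite /G !mxE; congr (_ - _); apply: eq_bigr => i _; by rewrite !mxE.
clearbody G.
have Gherm : G \is hermsymmx.
  apply/is_hermitianmxP; rewrite expr0 scale1r; apply/matrixP => l j.
  rewrite !(mxE, GE) rmorphB rmorphMn /= (geC0_conj c0) eq_sym; congr (_ - _).
  rewrite rmorph_sum; apply: eq_bigr => i _.
  by rewrite rmorphM /= conjCK mulrC.
set U := spectralmx G; set D := spectral_diag G.
have Uu : U \is unitarymx by exact: spectral_unitarymx.
have GD : G = U^t* *m diag_mx D *m U.
  have /orthomx_spectralP := hermitian_normalmx Gherm.
  by rewrite invmx_unitary.
have GDE l j : G l j = \sum_k (U k l)^* * D 0 k * U k j.
  rewrite GD mxE; apply: eq_bigr => k _.
  by rewrite mul_mx_diag !mxE.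
have Gform (v : 'cV[C]_d) : 0 <= \sum_l \sum_j (v l 0)^* * G l j * v j 0.
  have := Qc v; rewrite -subr_ge0 => /le_trans; apply.
  rewrite le_eqVlt; apply/orP; left; apply/eqP.
  under [in RHS]eq_bigr => l _ do under eq_bigr => j _ do
    rewrite GE mulrBr mulrBl.
  under [in RHS]eq_bigr => l _ do rewrite sumrB.
  rewrite sumrB; congr (_ - _).
    rewrite mulr_sumr; apply: eq_bigr => l _.
    rewrite (bigD1 l) //= eqxx mulr1n big1 ?addr0; last first.
      by move=> j; rewrite eq_sym => /negPf ->; rewrite mulr0n mulr0 mul0r.
    by rewrite normCK; ring.
  under [in RHS]eq_bigr => l _ do under eq_bigr => j _ do
    rewrite mulr_sumr mulr_suml.
  under [in RHS]eq_bigr => l _ do rewrite exchange_big.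
  rewrite exchange_big /=; apply: eq_bigr => i _.
  rewrite normCK !mxE rmorph_sum mulrC mulr_suml; apply: eq_bigr => l _.
  rewrite mulr_sumr; apply: eq_bigr => j _.
  by rewrite rmorphM /=; ring.
have D0 k : 0 <= D 0 k.
  have [v UV] : exists v : 'cV[C]_d, U *m v = delta_mx k 0.
    exists (U^t* *m delta_mx k 0).
    by rewrite mulmxA (unitarymxP Uu) mul1mx.
  suff -> : D 0 k = \sum_l \sum_j (v l 0)^* * G l j * v j 0 by [].
  have -> : \sum_l \sum_j (v l 0)^* * G l j * v j 0 = (v^t* *m G *m v) 0 0.
    rewrite mxE exchange_big; apply: eq_bigr => j _ /=.
    rewrite [(_ *m G) _ _]mxE mulr_suml; apply: eq_bigr => l _.
    by rewrite [(_ ^t*) _ _]mxE [_^T _ _]mxE.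
  rewrite GD !mulmxA -[v^t* *m _ *m _ *m _ *m _]mulmxA.
  have -> : v^t* *m U^t* = (U *m v)^t* by rewrite trmx_mul map_mxM.
  rewrite UV mxE (bigD1 k) //= big1 ?addr0.
    rewrite mul_mx_diag !mxE !eqxx /=; by rewrite rmorph1 mul1r mulr1.
  by move=> j /negPf jk; rewrite [delta_mx _ _ j _]mxE jk mulr0.
rewrite -subr_ge0.
have -> : c * (\sum_i B (x i) (x i)) - \sum_i B (y i) (y i) =
    \sum_k D 0 k * B (\sum_j U k j *: x j) (\sum_j U k j *: x j).
  have -> : \sum_i B (y i) (y i) =
      \sum_l \sum_j (\sum_i (Q i l)^* * Q i j) * B (x j) (x l).
    under eq_bigr => i _.
      rewrite /y sip_sumr; under eq_bigr => l _ do rewrite sip_suml mulr_sumr.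
      over.
    rewrite exchange_big /=; apply: eq_bigr => l _.
    rewrite exchange_big /=; apply: eq_bigr => j _.
    by rewrite mulr_suml; apply: eq_bigr => i _; rewrite mulrA.
  have -> : c * (\sum_i B (x i) (x i)) =
      \sum_l \sum_j (c *+ (l == j)) * B (x j) (x l).
    rewrite mulr_sumr; apply: eq_bigr => l _.
    rewrite (bigD1 l) //= eqxx big1 ?addr0 // => j.
    by rewrite eq_sym => /negPf ->; rewrite mulr0n mul0r.
  rewrite -sumrB.
  under eq_bigr => l _.
    rewrite -sumrB; under eq_bigr => j _.
      rewrite -mulrBl -GE GDE mulr_suml; over.
    rewrite exchange_big; over.
  rewrite exchange_big /=; apply: eq_bigr => k _.
  rewrite sip_sumr mulr_sumr; apply: eq_bigr => l _.
  rewrite sip_suml !mulr_sumr; apply: eq_bigr => j _.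
  by ring.
by apply: sumr_ge0 => k _; apply: mulr_ge0.
Qed.
End SemiInnerProduct.

(** This is the positivity of B at u - c v divided by c. *)
Lemma sip_young (C : numClosedFieldType) (H : lmodType C) (B : H -> H -> C)
    (c : C) (u v : H) :
  semi_inner_product B -> 0 < c ->
  B u v + (B u v)^* <= c^-1 * B u u + c * B v v.
Proof.
move=> [Bl Bh Bpos] c0; have c_neq0 : c != 0 by rewrite gt_eqF.
have cc : c^* = c by rewrite geC0_conj // ltW.
have cV_ge0 : 0 <= c^-1 by rewrite invr_ge0 ltW.
have := mulr_ge0 cV_ge0 (Bpos (- c *: v + u)).
rewrite Bl (Bh v) (Bh u (_ + _)) !Bl !rmorphD !rmorphM !rmorphN /= cc -!Bh.
rewrite -[B u v + _ <= _]subr_ge0.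
set lhs := (X in 0 <= X -> _) => lhs_ge0; rewrite (_ : _ - _ = lhs) //.
by rewrite /lhs; field.
Qed.

(** * Means over roots of unity *)
Section RootsOfUnity.
Variable C : numClosedFieldType.

Lemma exists_prim_root D : (0 < D)%N -> exists w : C, D.-primitive_root w.
Proof.
move=> D_gt0; have [r Er] := closed_field_poly_normal ('X^D - 1 : {poly C}).
rewrite (monicP (monicXnsubC 1 D_gt0)) scale1r in Er.
have r_uniq : uniq r.
  by rewrite -separable_prod_XsubC -Er separable_Xn_sub_1 // pnatr_eq0 -lt0n.
have r_size : size r = D.
  by apply/eqP; rewrite -eqSS -(size_prod_XsubC r id) -Er size_XnsubC.
have r_root : all D.-unity_root r.
  by apply/allP => z; rewrite -root_prod_XsubC -Er.
have /hasP[w _ ?] : has D.-primitive_root r.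
  by apply: has_prim_root; rewrite ?r_size.
by exists w.
Qed.

(** For w a primitive D-th root of unity and f a trigonometric polynomial of
    degree less than D, this is the mean of f over the unit circle. *)
Definition unity_mean D (w : C) (f : C -> C) : C :=
  D%:R^-1 * \sum_(j < D) f (w ^+ j).

Variables (D : nat) (w : C).
Hypothesis w_prim : D.-primitive_root w.

Lemma norm_prim_root_exp j : `|w ^+ j| = 1.
Proof.
rewrite normrX -[RHS](expr1n _ j); congr (_ ^+ _).
apply: (@pexpIrn _ D); rewrite ?nnegrE ?(prim_order_gt0 w_prim) //.
by rewrite -normrX (prim_expr_order w_prim) normr1 expr1n.
Qed.

Lemma unity_mean_monomial a b : (a < D)%N -> (b < D)%N ->
  unity_mean D w (fun s => s ^+ a * s^* ^+ b) = (a == b)%:R.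
Proof.
move=> aD bD; have D_gt0 := prim_order_gt0 w_prim.
have D_neq0 : D%:R != 0 :> C by rewrite pnatr_eq0 -lt0n.
have w1 : w * w^* = 1.
  by rewrite -normCK -[w]expr1 norm_prim_root_exp expr1n.
have wE : w ^+ a * w^* ^+ b * w ^+ b = w ^+ a.
  by rewrite -mulrA -exprMn [w^* * w]mulrC w1 expr1n mulr1.
have w_neq0 : w != 0.
  by apply/eqP => w0; move: w1; rewrite w0 mul0r => /eqP; rewrite eq_sym oner_eq0.
pose z := w ^+ a * w^* ^+ b.
have zD : z ^+ D = 1.
  rewrite exprMn -!exprM ![(_ * D)%N]mulnC !exprM -rmorphXn /=.
  by rewrite (prim_expr_order w_prim) rmorph1 !expr1n mulr1.
have -> : unity_mean D w (fun s => s ^+ a * s^* ^+ b)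
    = D%:R^-1 * \sum_(j < D) z ^+ j.
  congr (_ * _); apply: eq_bigr => j _.
  by rewrite exprMn -!exprM rmorphXn -!exprM ![(_ * j)%N]mulnC.
have z1 : (z == 1) = (a == b).
  rewrite -(inj_eq (mulIf (expf_neq0 b w_neq0))) wE mul1r.
  by rewrite (eq_prim_root_expr w_prim) !modn_small.
rewrite -z1; have [-> | z_neq1] := eqVneq z 1.
  by under eq_bigr do rewrite expr1n; rewrite sumr_const card_ord mulVf.
have /eqP := subrX1 z D; rewrite zD subrr eq_sym mulf_eq0 subr_eq0.
by rewrite (negPf z_neq1) => /eqP ->; rewrite mulr0.
Qed.

Lemma unity_mean_sum (I : Type) (r : seq I) (P : pred I) (f : I -> C -> C) :
  unity_mean D w (fun s => \sum_(i <- r | P i) f i s)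
  = \sum_(i <- r | P i) unity_mean D w (f i).
Proof. by rewrite /unity_mean exchange_big mulr_sumr. Qed.

Lemma unity_meanD (f g : C -> C) :
  unity_mean D w (fun s => f s + g s) = unity_mean D w f + unity_mean D w g.
Proof. by rewrite /unity_mean big_split mulrDr. Qed.

Lemma unity_meanB (f g : C -> C) :
  unity_mean D w (fun s => f s - g s) = unity_mean D w f - unity_mean D w g.
Proof. by rewrite /unity_mean sumrB mulrBr. Qed.

Lemma unity_meanZ a (f : C -> C) :
  unity_mean D w (fun s => a * f s) = a * unity_mean D w f.
Proof. by rewrite /unity_mean -mulr_sumr mulrCA. Qed.

Lemma unity_mean_conj (f : C -> C) :
  unity_mean D w (fun s => (f s)^*) = (unity_mean D w f)^*.
Proof. by rewrite /unity_mean rmorphM rmorph_sum fmorphV rmorph_nat. Qed.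

Lemma eq_unity_mean (f g : C -> C) :
  f =1 g -> unity_mean D w f = unity_mean D w g.
Proof. by move=> fg; congr (_ * _); apply: eq_bigr => j _; rewrite fg. Qed.

Lemma eq_unity_mean_circle (f g : C -> C) :
  (forall s, `|s| = 1 -> f s = g s) -> unity_mean D w f = unity_mean D w g.
Proof.
move=> fg; congr (_ * _); apply: eq_bigr => j _.
exact/fg/norm_prim_root_exp.
Qed.

Lemma unity_mean_le (f g : C -> C) :
  (forall s, `|s| = 1 -> f s <= g s) -> unity_mean D w f <= unity_mean D w g.
Proof.
move=> fg; rewrite ler_pM2l ?invr_gt0 ?ltr0n ?(prim_order_gt0 w_prim) //.
by apply: ler_sum => j _; apply/fg/norm_prim_root_exp.
Qed.

End RootsOfUnity.

(** * Truncated resolvents of an operator of numerical radius at most 1 *)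
Section TruncatedResolvent.
Variables (C : numClosedFieldType) (H : lmodType C) (ip : {dot H for Num.conj}).
Variable L : {linear H -> H}.

(** At u = v this is 2 Re <(1 - conj(s) L) u, u>; on vectors (1 - conj(s) L)^-1 x
    it is the kernel 2 Re (1 - conj(s) L)^-1. *)
Definition resolvent_form (s : C) (u v : H) : C :=
  ip (u - s^* *: L u) v + ip u (v - s^* *: L v).

Definition truncated_resolvent N (s : C) (x : H) : H :=
  \sum_(k < N) s^* ^+ k *: iter k L x.

(* Rewriting with the generic linearity lemmas may pick another linear map of the
   goal, such as L; these instances are for ip alone. *)
Lemma ipC u v : ip u v = (ip v u)^*.
Proof. by rewrite hermC expr0 mul1r. Qed.

Lemma ipBl u v w : ip (u - v) w = ip u w - ip v w.
Proof. exact: linearBl. Qed.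

Lemma ipZl a u w : ip (a *: u) w = a * ip u w.
Proof. exact: linearZl_LR. Qed.

Lemma ipBr u v w : ip w (u - v) = ip w u - ip w v.
Proof. exact: linearBr. Qed.

Lemma ipZr a u w : ip w (a *: u) = a^* * ip w u.
Proof. exact: linearZr_LR. Qed.

Lemma dot_sip : semi_inner_product ip.
Proof.
split=> [w a u v||u]; [exact: linearPl | exact: ipC | exact: dnorm_ge0].
Qed.

Lemma addC_conj_le (z : C) : z + z^* <= `|z| *+ 2.
Proof.
have -> : z + z^* = 'Re z *+ 2 by rewrite ReE -[RHS]mulr_natr mulfVK ?pnatr_eq0.
by rewrite lerMn2r leif_Re_Creal orbT.
Qed.

Lemma resolvent_form_ge (q : C) s u :
  `|s| = 1 -> `|ip (L u) u| <= q * ip u u ->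
  (1 - q) *+ 2 * ip u u <= resolvent_form s u u.
Proof.
move=> s1 Lq; rewrite /resolvent_form ipBl ipBr [ip u (s^* *: _)]ipC !ipZl.
set z := s^* * _; have z_le : `|z| <= q * ip u u.
  by rewrite /z normrM norm_conjC s1 mul1r.
have zz : z + z^* <= (q * ip u u) *+ 2.
  by rewrite (le_trans (addC_conj_le z)) // lerMn2r z_le orbT.
rewrite -subr_ge0; rewrite -subr_ge0 in zz.
by rewrite (_ : _ - _ = (q * ip u u) *+ 2 - (z + z^*)) //; ring.
Qed.

Lemma resolvent_form_sip (q : C) s :
  `|s| = 1 -> q <= 1 -> (forall u, `|ip (L u) u| <= q * ip u u) ->
  semi_inner_product (resolvent_form s).
Proof.
move=> s1 q1 Lq; have [ipl _ ip_ge0] := dot_sip; split=> [w a u v|u v|u].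
- rewrite /resolvent_form !ipl ipBl ipBl ipBl.
  rewrite linearP ipl ipZl ipl !ipZl; ring.
- rewrite /resolvent_form rmorphD addrC; congr (_ + _); exact: ipC.
- apply: le_trans (resolvent_form_ge s1 (Lq u)).
  by rewrite mulr_ge0 ?mulrn_wge0 ?subr_ge0.
Qed.

Lemma truncated_resolventE N s x :
  truncated_resolvent N s x - s^* *: L (truncated_resolvent N s x)
  = x - s^* ^+ N *: iter N L x.
Proof.
elim: N => [|N]; rewrite /truncated_resolvent.
  by rewrite big_ord0 linear0 scaler0 expr0 scale1r !subrr.
rewrite big_ord_recr; set y := (\sum_(k < N) _) => IH.
rewrite /= [L (_ + _)]linearD [L (_ *: _)]linearZ scalerDr opprD addrACA IH scalerA -exprS.
by rewrite addrA subrK.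
Qed.

Variables (D : nat) (w : C).
Hypothesis w_prim : D.-primitive_root w.

(** The m-th moment, over the circle, of the resolvent form at the truncated
    resolvents of x and x'.  The term <x, x'> occurs once more for m = 0 because
    the form is a sum of two halves that share their constant term.  The term
    with a minus sign is the effect of the truncation at N. *)
Lemma sum_ord_select (p : pred nat) N j (F : nat -> C) :
  (forall k, (k < N)%N -> p k = (k == j)) ->
  \sum_(k < N) F k * (p k)%:R = if (j < N)%N then F j else 0.
Proof.
move=> pE; rewrite -(@big_ord1_eq C 0 +%R F j N) [RHS]big_mkcond.
by apply: eq_bigr => k _ /=; rewrite pE //; case: eqP; rewrite ?mulr1 ?mulr0.
Qed.

Definition resolvent_coef N m x x' : C :=
  (m == 0%N)%:R * ip x x' - (m != 0%N)%:R * ip (iter N L x) (iter (N - m) L x')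
  + ip (iter m L x) x'.

(** By the truncated geometric sum, each argument of the form collapses to two
    terms, so only four families of monomials remain; orthogonality keeps at most
    one monomial of each. *)
Lemma mean_resolvent_form N m x x' : (m < N)%N -> (N.*2 < D)%N ->
  unity_mean D w (fun s => s ^+ m *
    resolvent_form s (truncated_resolvent N s x) (truncated_resolvent N s x'))
  = resolvent_coef N m x x'.
Proof.
move=> mN ND.
have sip := dot_sip.
pose M a b := fun s : C => s ^+ a * s^* ^+ b.
rewrite (eq_unity_mean D w (g := fun s =>
   (\sum_(k < N) ip x (iter k L x') * M (m + k)%N 0%N s
   - \sum_(k < N) ip (iter N L x) (iter k L x') * M (m + k)%N N s)
 + (\sum_(k < N) ip (iter k L x) x' * M m k s
   - \sum_(k < N) ip (iter k L x) (iter N L x') * M (m + N)%N k s))); last first.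
  move=> s; rewrite /resolvent_form !truncated_resolventE !ipBl !ipBr ipZl ipZr.
  rewrite /truncated_resolvent !(sip_suml sip) !(sip_sumr sip) /M.
  rewrite mulrDr !mulrBr !mulr_sumr.
  congr ((_ - _) + (_ - _)); apply: eq_bigr => k _;
    rewrite ?rmorphXn /= ?conjCK ?exprD ?expr0; ring.
rewrite unity_meanD !unity_meanB !unity_mean_sum.
have mean a b c : (a < D)%N -> (b < D)%N ->
    unity_mean D w (fun s => c * M a b s) = c * (a == b)%:R.
  by move=> aD bD; rewrite unity_meanZ unity_mean_monomial.
have sum1 : \sum_(k < N) unity_mean D w
    (fun s => ip x (iter k L x') * M (m + k)%N 0%N s) = (m == 0%N)%:R * ip x x'.
  rewrite (eq_bigr (fun k : 'I_N => ip x (iter k L x') * ((m + k)%N == 0%N)%:R));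
    last by move=> k _; have := ltn_ord k => kN; rewrite mean //; lia.
  rewrite (@sum_ord_select (fun k => (m + k)%N == 0%N) N (if m == 0 then 0 else N)%N
    (fun k => ip x (iter k L x'))); last first.
    by move=> k kN; case: (m =P 0%N); lia.
  by case: (m =P 0%N) => m0; rewrite ?mul1r ?mul0r ?ltnn // ifT //; lia.
have sum2 : \sum_(k < N) unity_mean D w
    (fun s => ip (iter N L x) (iter k L x') * M (m + k)%N N s)
    = (m != 0%N)%:R * ip (iter N L x) (iter (N - m) L x').
  rewrite (eq_bigr (fun k : 'I_N =>
      ip (iter N L x) (iter k L x') * ((m + k)%N == N)%:R));
    last by move=> k _; have := ltn_ord k => kN; rewrite mean //; lia.
  rewrite (@sum_ord_select (fun k => (m + k)%N == N) N (N - m)%N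
    (fun k => ip (iter N L x) (iter k L x'))); last by move=> k kN; lia.
  rewrite (_ : (N - m < N)%N = (m != 0%N)); last by lia.
  by case: (m != 0%N); rewrite ?mul1r ?mul0r.
have sum3 : \sum_(k < N) unity_mean D w
    (fun s => ip (iter k L x) x' * M m k s) = ip (iter m L x) x'.
  rewrite (eq_bigr (fun k : 'I_N => ip (iter k L x) x' * (m == k)%N%:R));
    last by move=> k _; have := ltn_ord k => kN; rewrite mean //; lia.
  by rewrite (@sum_ord_select (fun k => m == k) N m
    (fun k => ip (iter k L x) x')) ?mN // => k _; rewrite eq_sym.
have sum4 : \sum_(k < N) unity_mean D w
    (fun s => ip (iter k L x) (iter N L x') * M (m + N)%N k s) = 0.
  rewrite big1 // => k _; have := ltn_ord k => kN; rewrite mean; try lia.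
  by rewrite (_ : (m + N == k)%N = false) ?mulr0 //; lia.
by rewrite sum1 sum2 sum3 sum4 subr0.
Qed.

End TruncatedResolvent.

(** * The inequality in one variable *)
Section OneVariable.
Variables (C : numClosedFieldType) (H : lmodType C) (ip : {dot H for Num.conj}).
Variables (L : {linear H -> H}) (q : C).
Hypothesis q_lt1 : q < 1.
Hypothesis Lq : forall u, `|ip (L u) u| <= q * ip u u.

Lemma mean_resolvent_dnorm D (w : C) N x : D.-primitive_root w ->
  (0 < N)%N -> (N.*2 < D)%N ->
  unity_mean D w (fun s => resolvent_form ip L s
    (truncated_resolvent L N s x) (truncated_resolvent L N s x)) = ip x x *+ 2.
Proof.
move=> w_prim N_gt0 ND.
transitivity (resolvent_coef ip L N 0 x x).
  rewrite -(mean_resolvent_form ip L w_prim) //.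
  by apply: eq_unity_mean => s; rewrite expr0 mul1r.
by rewrite /resolvent_coef eqxx mul1r mul0r subr0.
Qed.

(** The mean of the resolvent form at y = sum of conj(s)^l L^l x is 2 |x|^2, and
    the form is at least 2 (1 - q) |y|^2, whose mean is 2 (1 - q) times the sum
    of all |L^l x|^2 by orthogonality. *)
Lemma dnorm_iter_le k x : (1 - q) * ip (iter k L x) (iter k L x) <= ip x x.
Proof.
pose N := k.+1; pose D := N.*2.+1.
have [w w_prim] := @exists_prim_root C D isT.
have q1 : 0 <= 1 - q by rewrite subr_ge0 ltW.
have : unity_mean D w (fun s => (1 - q) *+ 2 *
    ip (truncated_resolvent L N s x) (truncated_resolvent L N s x))
    <= ip x x *+ 2.
  rewrite -(@mean_resolvent_dnorm D w N) //; apply: (unity_mean_le w_prim).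
  by move=> s s1; apply: resolvent_form_ge.
rewrite unity_meanZ.
have -> : unity_mean D w (fun s =>
    ip (truncated_resolvent L N s x) (truncated_resolvent L N s x))
    = \sum_(l < N) ip (iter l L x) (iter l L x).
  rewrite (eq_unity_mean D w (g := fun s => \sum_(l < N) \sum_(m < N)
    ip (iter m L x) (iter l L x) * (s ^+ l * s^* ^+ m))).
    rewrite unity_mean_sum; apply: eq_bigr => l _.
    rewrite unity_mean_sum (bigD1 l) //= big1.
      rewrite unity_meanZ (unity_mean_monomial w_prim) ?eqxx ?mulr1 ?addr0 //;
        by have := ltn_ord l; rewrite /D; lia.
    move=> m; rewrite -val_eqE /= => ml.
    rewrite unity_meanZ (unity_mean_monomial w_prim) 1?eq_sym ?(negPf ml) ?mulr0 //.
      by have := ltn_ord l; rewrite /D; lia.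
    by have := ltn_ord m; rewrite /D; lia.
  move=> s; rewrite /truncated_resolvent (sip_sumr (dot_sip ip)).
  apply: eq_bigr => l _; rewrite (sip_suml (dot_sip ip)) mulr_sumr.
  by apply: eq_bigr => m _; rewrite rmorphXn /= conjCK; ring.
rewrite mulrnAl lerMn2r /=; apply: le_trans.
rewrite ler_wpM2l // big_ord_recr /= lerDr.
by apply: sumr_ge0 => l _; apply: dnorm_ge0.
Qed.

(** The inequality up to the truncation error.  At each point s of the circle the
    symbol increases the seminorm given by the resolvent form by a factor at most
    c; then the mean is taken. *)
Lemma matrix_resolvent_le d N E (Q : nat -> 'M[C]_d) (c : C) (x z : 'I_d -> H) :
  0 < c -> (0 < N)%N -> (E <= N)%N ->
  (forall s (v : 'cV[C]_d), `|s| = 1 ->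
     \sum_i `|((\sum_(m < E) s ^+ m *: Q m) *m v) i 0| ^+ 2
       <= c ^+ 2 * \sum_i `|v i 0| ^+ 2) ->
  let X := \sum_i \sum_j \sum_(m < E)
             Q m i j * resolvent_coef ip L N m (x j) (z i) in
  X + X^* <= c * (\sum_i ip (x i) (x i) + \sum_i ip (z i) (z i)) *+ 2.
Proof.
move=> c_gt0 N_gt0 EN Qc /=; set X := (\sum_i \sum_j _); pose D := N.*2.+1.
have [w w_prim] := @exists_prim_root C D isT.
pose y (u : 'I_d -> H) s i := truncated_resolvent L N s (u i).
pose B := resolvent_form ip L.
pose Qs s : 'M[C]_d := \sum_(m < E) s ^+ m *: Q m.
pose F s := \sum_i B s (\sum_j Qs s i j *: y x s j) (y z s i).
have Bsip s : `|s| = 1 -> semi_inner_product (B s).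
  by move=> s1; apply: resolvent_form_sip Lq; rewrite ?ltW.
have FX : unity_mean D w F = X.
  rewrite (@eq_unity_mean_circle _ _ _ w_prim _ (fun s => \sum_i \sum_j \sum_(m < E)
      Q m i j * (s ^+ m * B s (y x s j) (y z s i)))).
    rewrite unity_mean_sum; apply: eq_bigr => i _.
    rewrite unity_mean_sum; apply: eq_bigr => j _.
    rewrite unity_mean_sum; apply: eq_bigr => m _.
    rewrite unity_meanZ (mean_resolvent_form ip L w_prim) //.
    exact: leq_trans (ltn_ord m) EN.
  move=> s s1; apply: eq_bigr => i _.
  rewrite (sip_suml (Bsip s s1)); apply: eq_bigr => j _.
  rewrite /Qs summxE mulr_suml; apply: eq_bigr => m _.
  by rewrite mxE; ring.
have -> : X + X^* = unity_mean D w (fun s => F s + (F s)^*).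
  by rewrite unity_meanD unity_mean_conj FX.
have -> : c * (\sum_i ip (x i) (x i) + \sum_i ip (z i) (z i)) *+ 2 =
  unity_mean D w (fun s => c * (\sum_i B s (y x s i) (y x s i)
     + \sum_i B s (y z s i) (y z s i))).
  rewrite unity_meanZ unity_meanD !unity_mean_sum -mulrnAr mulrnDl -!sumrMnl.
  by congr (_ * (_ + _)); apply: eq_bigr => i _;
     rewrite /B mean_resolvent_dnorm.
apply: (unity_mean_le w_prim) => s s1.
have c2 : 0 <= c ^+ 2 by rewrite exprn_ge0 ?ltW.
have := @sip_contraction _ _ _ (Bsip s s1) d (Qs s) (c ^+ 2) (y x s) c2 (Qc s ^~ s1).
rewrite /=; set T := \sum_i B s (\sum_j _) _ => TX.
apply: (@le_trans _ _ (c^-1 * T + c * \sum_i B s (y z s i) (y z s i))).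
  rewrite /F rmorph_sum /T !mulr_sumr -!big_split /=.
  by apply: ler_sum => i _; apply: sip_young (Bsip s s1) _.
rewrite mulrDr lerD2r -(ler_pM2l c_gt0) mulrA divff ?gt_eqF // mul1r.
by rewrite mulrA -expr2.
Qed.
End OneVariable.

(** The three limits of the proof go through this lemma: the truncation order
    tends to infinity, the scaling factor tends to 1, and the mean over the sphere
    is refined, each with a geometrically small error. *)
Lemma le_of_geometric (R : realType) (t a b K : R[i]) :
  0 <= t < 1 -> 0 <= K -> (forall l, a <= b + K * t ^+ l) -> a <= b.
Proof.
move=> /andP[t_ge0 t_lt1] K0 h.
have tR : t = (complex.Re t)%:C%C by exact/esym/RRe_real/ger0_real.
move: tR t_ge0 t_lt1 h; move: (complex.Re t) => {}t -> t0 t1 h.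
rewrite -[0]/(0%:C%C) lecR in t0; rewrite -[1]/(1%:C%C) ltcR in t1.
have KR : K = (complex.Re K)%:C%C by exact/esym/RRe_real/ger0_real.
have {}h l : a <= b + (complex.Re K * t ^+ l)%:C%C by rewrite rmorphM rmorphXn /= -KR.
have /eqP abI : complex.Im b == complex.Im a.
  by have := h 0%N; rewrite lecE /= ?raddfD /= ?addr0 => /andP[].
rewrite lecE abI eqxx /=.
have lim : (fun l => complex.Re b + complex.Re K * t ^+ l) @ \oo --> complex.Re b.
  rewrite -[X in _ --> X]addr0 -[X in _ + X](mulr0 (complex.Re K)).
  apply: cvgD; first exact: cvg_cst.
  by apply: cvgMr; apply: cvg_expr; rewrite ger0_norm.
apply: (cvgr_to_ge lim); apply: nearW => l.
by have := h l; rewrite lecE => /andP[_]; rewrite raddfD.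
Qed.

(** Only this weak form of the Cauchy-Schwarz inequality is used: rotate u so
    that the product becomes real, then expand the square of u - v. *)
Lemma ip_norm_le (C : numClosedFieldType) (H : lmodType C) (ip : {dot H for Num.conj})
   u v : `|ip u v| *+ 2 <= ip u u + ip v v.
Proof.
have [->|nz] := eqVneq (ip u v) 0.
  by rewrite normr0 mul0rn addr_ge0 // dnorm_ge0.
have a1 : `| `|ip u v| / ip u v| = 1.
  by rewrite normrM normr_id normfV divff // normr_eq0.
have := @sip_young _ _ _ 1 ((`|ip u v| / ip u v) *: u) v (dot_sip ip) ltr01.
rewrite dnormZ a1 expr1n invr1 !mul1r ipZl divfK // geC0_conj //.
Qed.

Section OneVariableLimit.
Variables (R : realType) (H : lmodType R[i]) (ip : {dot H for Num.conj}).
Variable A : {linear H -> H}.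
Hypothesis A1 : forall u, `|ip (A u) u| <= ip u u.

Lemma iter_scale (a : R[i]) k x : iter k (a \*: A) x = a ^+ k *: iter k A x.
Proof.
elim: k => [|k IH]; first by rewrite expr0 scale1r.
by rewrite !iterS IH /= linearZ scalerA -exprS.
Qed.

Lemma scaled_numerical_radius (a : R[i]) u : 0 <= a -> `|ip ((a \*: A) u) u| <= a * ip u u.
Proof.
by move=> a0; rewrite ipZl normrM (ger0_norm a0) ler_wpM2l.
Qed.

(** The a priori bound on the powers of t A leaves a factor t^k when it is
    applied to the powers of t^2 A; this is why the operator is scaled by a
    square. *)
Lemma dnorm_iter_decay (t : R[i]) k x : 0 < t < 1 ->
  ip (iter k (t ^+ 2 \*: A) x) (iter k (t ^+ 2 \*: A) x)
  <= ((1 - t)^-1 * ip x x) * (t ^+ 2) ^+ k.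
Proof.
move=> /andP[t0 t1].
have := @dnorm_iter_le _ _ ip (t \*: A) _ t1
  (fun u => scaled_numerical_radius u (ltW t0)) k x.
rewrite !iter_scale !dnormZ -ler_pdivlMl ?subr_gt0 // => h.
rewrite [leRHS]mulrC.
rewrite !ger0_norm ?exprn_ge0 ?(ltW t0) // in h *.
have tk : 0 <= t ^+ 2 ^+ k by rewrite !exprn_ge0 ?ltW.
apply: le_trans (ler_wpM2l tk h); rewrite mulrA.
rewrite (_ : (t ^+ 2 ^+ k) ^+ 2 = t ^+ 2 ^+ k * t ^+ k ^+ 2) //.
by rewrite -!exprM -exprD; congr (_ ^+ _); lia.
Qed.

(** Twice <(Q_0 + (1/2) sum over m >= 1 of t^m Q_m A^m) x, z>, the first argument
    acting on d-tuples of vectors. *)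
Definition caratheodory_form d E (Q : nat -> 'M[R[i]]_d) (t : R[i]) (x z : 'I_d -> H) :=
  \sum_i \sum_j \sum_(m < E)
    Q m i j * ((m == 0%N :> nat)%:R + 1) * t ^+ m * ip (iter m A (x j)) (z i).

Lemma caratheodory_form_le_scaled d E (Q : nat -> 'M[R[i]]_d) (c t : R[i])
    (x z : 'I_d -> H) :
  0 < c -> 0 < t < 1 ->
  (forall s (v : 'cV[R[i]]_d), `|s| = 1 ->
     \sum_i `|((\sum_(m < E) s ^+ m *: Q m) *m v) i 0| ^+ 2
       <= c ^+ 2 * \sum_i `|v i 0| ^+ 2) ->
  caratheodory_form E Q (t ^+ 2) x z + (caratheodory_form E Q (t ^+ 2) x z)^*
  <= c * (\sum_i ip (x i) (x i) + \sum_i ip (z i) (z i)) *+ 2.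
Proof.
move=> c_gt0 t01 Qc; have /andP[t0 t1] := t01.
have T0 : 0 < t ^+ 2 by rewrite exprn_gt0.
have T1 : t ^+ 2 < 1 by rewrite expr_lt1 // ltW.
pose L := t ^+ 2 \*: A; pose k (u : H) := (1 - t)^-1 * ip u u.
have k0 u : 0 <= k u by rewrite mulr_ge0 ?dnorm_ge0 // invr_ge0 subr_ge0 ltW.
pose K := \sum_i \sum_j \sum_(m < E) `|Q m i j| * (k (x j) + k (z i)).
have K0 : 0 <= K.
  by do 3![apply: sumr_ge0 => ? _]; rewrite mulr_ge0 ?addr_ge0.
apply: (@le_of_geometric _ (t ^+ 2) _ _ K) => //; first by rewrite (ltW T0).
move=> l; pose N := (E + l).+1.
have := @matrix_resolvent_le _ _ ip L _ T1 (fun u => scaled_numerical_radius u (ltW T0))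
  d N E Q c x z c_gt0 isT ltac:(rewrite /N; lia) Qc.
pose err := \sum_i \sum_j \sum_(m < E)
  Q m i j * ((m != 0%N :> nat)%:R * ip (iter N L (x j)) (iter (N - m) L (z i))).
rewrite /=; set X := (\sum_i \sum_j _); have -> : X = caratheodory_form E Q (t ^+ 2) x z - err.
  rewrite /X /caratheodory_form /err -sumrB; apply: eq_bigr => i _.
  rewrite -sumrB; apply: eq_bigr => j _; rewrite -sumrB; apply: eq_bigr => m _.
  rewrite /resolvent_coef [iter m L _]iter_scale [ip (_ ^+ m *: _) _]ipZl.
  move: (ip (iter N L (x j)) (iter (N - m) L (z i))) => e.
  by have [->|m0] := eqVneq (m : nat) 0%N; rewrite ?expr0 /=; ring.
set Y := caratheodory_form _ _ _ _ _ => XY.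
have errK : `|err| *+ 2 <= K * t ^+ 2 ^+ l.
  have decay N' u : (l <= N')%N -> ip (iter N' L u) (iter N' L u) <= k u * t ^+ 2 ^+ l.
    move=> lN; apply: le_trans (dnorm_iter_decay _ _ t01) _.
    by rewrite ler_wpM2l ?k0 // ler_wiXn2l ?ltW // (ltW T0).
  have : `|err| <= \sum_i \sum_j \sum_(m < E) `|Q m i j| *
      `|(m != 0%N :> nat)%:R * ip (iter N L (x j)) (iter (N - m) L (z i))|.
    rewrite /err; do 3!
      [apply: le_trans (ler_norm_sum _ _ _) _; apply: ler_sum => ? _].
    by rewrite normrM.
  move=> /(ler_wMn2r 2) /le_trans; apply.
  rewrite /K mulr_suml -sumrMnl; apply: ler_sum => i _.
  rewrite mulr_suml -sumrMnl; apply: ler_sum => j _.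
  rewrite mulr_suml -sumrMnl; apply: ler_sum => m _.
  rewrite -mulrnAr -mulrA ler_wpM2l // normrM mulrDl.
  apply: (@le_trans _ _ (`|ip (iter N L (x j)) (iter (N - m) L (z i))| *+ 2)).
    by rewrite lerMn2r /= ler_piMl // normr_nat; case: (_ == _); rewrite /= ?ler01 ?lexx.
  apply: le_trans (ip_norm_le _ _ _) _; apply: lerD; apply: decay; rewrite /N.
    lia.
  have := ltn_ord m; lia.
have -> : Y + Y^* = (Y - err) + (Y - err)^* + (err + err^*) by rewrite rmorphB; ring.
apply: lerD => //; exact: le_trans (addC_conj_le err) errK.
Qed.

Lemma one_sub_exp_le (F : numDomainType) (t : F) k :
  0 <= t <= 1 -> 1 - t ^+ k <= k%:R * (1 - t).
Proof.
move=> /andP[t0 t1]; elim: k => [|k IH]; first by rewrite expr0 subrr mul0r.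
have -> : 1 - t ^+ k.+1 = (1 - t ^+ k) + t ^+ k * (1 - t) by rewrite exprS; ring.
rewrite -[k.+1]addn1 natrD mulrDl lerD // ler_wpM2r ?subr_ge0 //.
by rewrite exprn_ile1.
Qed.

(** The scaled inequality extends to t = 1, since the form is a polynomial in t
    and 1 - t^k <= k (1 - t). *)
Lemma caratheodory_form_le d E (Q : nat -> 'M[R[i]]_d) (c : R[i]) (x z : 'I_d -> H) :
  0 < c ->
  (forall s (v : 'cV[R[i]]_d), `|s| = 1 ->
     \sum_i `|((\sum_(m < E) s ^+ m *: Q m) *m v) i 0| ^+ 2
       <= c ^+ 2 * \sum_i `|v i 0| ^+ 2) ->
  caratheodory_form E Q 1 x z + (caratheodory_form E Q 1 x z)^*
  <= c * (\sum_i ip (x i) (x i) + \sum_i ip (z i) (z i)) *+ 2.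
Proof.
move=> c_gt0 Qc.
pose K := \sum_i \sum_j \sum_(m < E)
   `|Q m i j * ((m == 0%N :> nat)%:R + 1) * ip (iter m A (x j)) (z i)|
   * (2 * m)%N%:R.
have K0 : 0 <= K by do 3![apply: sumr_ge0 => ? _]; rewrite mulr_ge0.
apply: (@le_of_geometric _ 2^-1 _ _ (K *+ 2)); rewrite ?mulrn_wge0 //.
  by rewrite invr_ge0 ler0n invf_lt1 ?ltr0n ?ltr1n.
move=> l; pose e : R[i] := 2^-1 ^+ l.+1; pose t := 1 - e.
have e0 : 0 < e by rewrite exprn_gt0 // invr_gt0 ltr0n.
have e1 : e < 1 by rewrite exprn_ilt1 ?invr_ge0 ?ler0n // invf_lt1 ?ltr0n ?ltr1n.
have t01 : 0 < t < 1 by rewrite /t subr_gt0 e1 ltrBlDr ltrDl.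
have t01w : 0 <= t <= 1 by case/andP: t01 => /ltW -> /ltW.
set Y1 := caratheodory_form E Q 1 x z; pose Yt := caratheodory_form E Q (t ^+ 2) x z.
have YK : `|Y1 - Yt| <= K * e.
  rewrite /Y1 /Yt /caratheodory_form /K -sumrB mulr_suml.
  apply: le_trans (ler_norm_sum _ _ _) _; apply: ler_sum => i _.
  rewrite -sumrB mulr_suml.
  apply: le_trans (ler_norm_sum _ _ _) _; apply: ler_sum => j _.
  rewrite -sumrB mulr_suml.
  apply: le_trans (ler_norm_sum _ _ _) _; apply: ler_sum => m _.
  set q := Q m i j * _; set p := ip _ _.
  have -> : q * 1 ^+ m * p - q * t ^+ 2 ^+ m * p = q * p * (1 - t ^+ (2 * m)).
    by rewrite expr1n -exprM; ring.
  rewrite normrM -mulrA ler_wpM2l // ger0_norm.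
    have -> : e = 1 - t by rewrite /t; ring.
    exact: one_sub_exp_le.
  by rewrite subr_ge0 exprn_ile1 //; case/andP: t01w.
have -> : Y1 + Y1^* = Yt + Yt^* + ((Y1 - Yt) + (Y1 - Yt)^*) by rewrite rmorphB; ring.
apply: lerD; first exact: caratheodory_form_le_scaled.
apply: le_trans (addC_conj_le _) _.
rewrite mulrnAl lerMn2r /= (le_trans YK) // ler_wpM2l // /e.
by rewrite exprS ler_piMl ?exprn_ge0 ?invr_ge0 ?ler0n // invf_le1 ?ltr0n ?ler1n.
Qed.
End OneVariableLimit.

(** * Moments of the uniform measure on the simplex *)
Section Compositions.
Local Open Scope nat_scope.

(** The lists of n.+1 natural numbers, zero allowed, with sum N. *)
Fixpoint compositions n N : seq (seq nat) :=
  if n is n'.+1 then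
    flatten [seq [seq a :: s | s <- compositions n' (N - a)] | a <- iota 0 N.+1]
  else [:: [:: N]].

Lemma compositionsS n N : compositions n.+1 N =
  flatten [seq [seq a :: s | s <- compositions n (N - a)] | a <- iota 0 N.+1].
Proof. by []. Qed.

Lemma sum_nth_composition n N s : s \in compositions n N ->
  \sum_(i < n.+1) nth 0 s i = N.
Proof.
elim: n N s => [|n IH] N s.
  by rewrite /= inE => /eqP ->; rewrite big_ord_recl big_ord0 addn0.
rewrite compositionsS => /flatten_mapP[] => a; rewrite mem_iota add0n => /andP[_ aN].
case/mapP => s' s'_in ->; rewrite big_ord_recl /= (IH _ _ s'_in).
by rewrite subnKC // -ltnS.
Qed.

Lemma big_compositions (F : seq nat -> nat) n N :
  \sum_(s <- compositions n.+1 N) F s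
  = \sum_(0 <= a < N.+1) \sum_(s <- compositions n (N - a)) F (a :: s).
Proof.
rewrite compositionsS big_flatten big_map /index_iota subn0.
by apply: eq_bigr => a _; rewrite big_map.
Qed.

(** Vandermonde's identity for the lower index: choose p + q + 1 elements among
    M + 1 according to the position a of the (p + 1)-st. *)
Lemma sum_bin_convolution M p q :
  \sum_(0 <= a < M.+1) 'C(a, p) * 'C(M - a, q) = 'C(M.+1, (p + q).+1).
Proof.
elim: M q => [|M IH] q.
  rewrite big_nat1 sub0n; case: p q => [|p] [|q];
    by rewrite ?bin0n //= ?bin_small ?muln0 //; lia.
rewrite big_nat_recr //= subnn; case: q => [|q].
  have -> : \sum_(0 <= a < M.+1) 'C(a, p) * 'C(M.+1 - a, 0) =
            \sum_(0 <= a < M.+1) 'C(a, p) * 'C(M - a, 0).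
    by apply: eq_bigr => a _; rewrite !bin0.
  by rewrite IH bin0 muln1 addn0 [in RHS]binS addnC.
rewrite bin0n muln0 addn0.
have -> : \sum_(0 <= a < M.+1) 'C(a, p) * 'C(M.+1 - a, q.+1) =
  \sum_(0 <= a < M.+1) ('C(a, p) * 'C(M - a, q.+1) + 'C(a, p) * 'C(M - a, q)).
  rewrite !big_nat; apply: eq_bigr => a /andP[_ aM].
  by rewrite subSn ?binS ?mulnDr.
by rewrite big_split /= !IH [in RHS]binS addnS.
Qed.

(** Iterating [sum_bin_convolution] gives the binomial moments of the uniform
    measure on compositions in closed form. *)
Lemma sum_compositions_bin n N (al : nat -> nat) :
  \sum_(s <- compositions n N) \prod_(i < n.+1) 'C(nth 0 s i, al i)
  = 'C(N + n, \sum_(i < n.+1) al i + n).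
Proof.
elim: n N al => [|n IH] N al.
  by rewrite /= big_seq1 !big_ord_recl !big_ord0 /= muln1 !addn0.
rewrite big_compositions.
have -> : \sum_(0 <= a < N.+1) \sum_(s <- compositions n (N - a))
     \prod_(i < n.+2) 'C(nth 0 (a :: s) i, al i)
  = \sum_(0 <= a < N.+1)
      'C(a, al 0) * 'C(N + n - a, \sum_(i < n.+1) al i.+1 + n).
  rewrite !big_nat; apply: eq_bigr => a /andP[_ aN].
  have -> : N + n - a = N - a + n by lia.
  rewrite -(IH (N - a) (fun i => al i.+1)) big_distrr /=; apply: eq_bigr => s _.
  by rewrite big_ord_recl; congr (_ * _); apply: eq_bigr => i _.
have := sum_bin_convolution (N + n) (al 0) (\sum_(i < n.+1) al i.+1 + n).
rewrite (big_cat_nat (n := N.+1)) //=; last by lia.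
rewrite [X in _ + X]big_nat [X in _ + X]big1 ?addn0.
  move=> ->; rewrite addnS [in RHS]big_ord_recl /= addnS addnA.
  by congr 'C(_, (_ + _ + _).+1); apply: eq_bigr.
by move=> a /andP[Na aM]; rewrite ['C(N + n - a, _)]bin_small ?muln0 //; lia.
Qed.

Lemma size_compositions n N : size (compositions n N) = 'C(N + n, n).
Proof.
rewrite -sum1_size; have := sum_compositions_bin n N (fun=> 0).
rewrite [X in 'C(_, X + _)]big1 // add0n => <-; apply: eq_bigr => s _.
by rewrite big1 // => i _; rewrite bin0.
Qed.

Lemma ffactDl n N k : (N + n) ^_ (n + k) = (N + n) ^_ n * N ^_ k.
Proof.
elim: n => [|n IH]; first by rewrite addn0 add0n mul1n.
by rewrite addnS addSn !ffactSS IH mulnA.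
Qed.

(** The mean of a product of falling factorials is
    n! a! / (n + |a|)! times N (N - 1) ... (N - |a| + 1). *)
Lemma sum_compositions_ffact n N (al : nat -> nat) :
  let k := \sum_(i < n.+1) al i in
  (\sum_(s <- compositions n N) \prod_(i < n.+1) nth 0 s i ^_ al i) * (k + n)`!
  = size (compositions n N) * (\prod_(i < n.+1) (al i)`!) * n`! * N ^_ k.
Proof.
move=> k; under eq_bigr => s _ do under eq_bigr => i _ do rewrite -bin_ffact.
under eq_bigr => s _ do rewrite big_split /=.
rewrite -big_distrl /= sum_compositions_bin size_compositions -/k.
have := bin_ffact (N + n) (k + n); have := bin_ffact (N + n) n.
have -> : (N + n) ^_ (k + n) = (N + n) ^_ n * N ^_ k.
  by rewrite [(k + n)%N]addnC ffactDl.
nia.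
Qed.
End Compositions.

Section SimplexMoments.
Variable C : numFieldType.

(** Scaled falling factorials differ from powers by O(1/N), which turns exact
    falling factorial moments into asymptotic moments. *)
Lemma ffact_scaled_close N m a : (0 < N)%N -> (m <= N)%N ->
  let u := (m%:R / N%:R) ^+ a : C in let v := (m ^_ a)%:R / N%:R ^+ a : C in
  [/\ 0 <= u <= 1, 0 <= v <= 1 & `|u - v| <= (a ^ 2)%:R / N%:R].
Proof.
move=> N_gt0 mN; have N0 : 0 < N%:R :> C by rewrite ltr0n.
have Nn0 : N%:R != 0 :> C by rewrite gt_eqF.
have q01 : 0 <= (m%:R / N%:R : C) <= 1.
  apply/andP; split; first by rewrite divr_ge0.
  by rewrite ler_pdivrMr // mul1r ler_nat.
suff : forall b, let u := (m%:R / N%:R) ^+ b : C in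
    let v := (m ^_ b)%:R / N%:R ^+ b : C in
    [/\ 0 <= u <= 1, 0 <= v <= 1 & 0 <= u - v <= (b ^ 2)%:R / N%:R].
  by move=> /(_ a) [u01 v01 /andP[uv0 uv]] /=; rewrite ger0_norm.
elim=> [|b [/andP[u0 u1] /andP[v0 v1] /andP[uv0 uv]]]; rewrite /=.
  by rewrite ffactn0 !expr0 divr1 subrr lexx ler01; split=> //; rewrite lexx divr_ge0.
rewrite [_ ^+ b.+1]exprS ffactnSr natrM exprSr.
set u := (_ ^+ b) in u0 u1 uv0 uv *; set v := _ / _ in v0 v1 uv0 uv.
pose r : C := (m - b)%:R / N%:R.
have -> : (m ^_ b)%:R * (m - b)%:R / (N%:R ^+ b * N%:R) = v * r.
  by rewrite /v /r invfM; ring.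
have r01 : 0 <= r <= 1.
  apply/andP; split; first by rewrite divr_ge0.
  by rewrite ler_pdivrMr // mul1r ler_nat (leq_trans (leq_subr _ _)).
have qr : 0 <= m%:R / N%:R - r <= b%:R / N%:R.
  rewrite /r -mulrBl -natrB ?leq_subr //.
  rewrite divr_ge0 //= ler_pM2r ?invr_gt0 // ler_nat.
  by rewrite leq_subLR addnC -leq_subLR.
have /andP[q0 q1] := q01; have /andP[r0 r1] := r01; have /andP[qr0 qr1] := qr.
split; try by apply/andP; split; [exact: mulr_ge0 | exact: mulr_ile1].
have -> : m%:R / N%:R * u - v * r = m%:R / N%:R * (u - v) + v * (m%:R / N%:R - r).
  by ring.
rewrite addr_ge0 ?mulr_ge0 //=.
apply: (@le_trans _ _ ((b ^ 2)%:R / N%:R + b%:R / N%:R)).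
  apply: lerD.
    by apply: le_trans uv; rewrite ler_piMl.
  by apply: le_trans qr1; rewrite ler_piMl.
rewrite -mulrDl -natrD ler_pM2r ?invr_gt0 // ler_nat.
by rewrite -[b.+1]addn1 sqrnD -addnA leq_add2l muln1 mul2n -addnn addnCA leq_addr.
Qed.

Lemma prod_close (I : Type) (r : seq I) (u v : I -> C) :
  (forall i, 0 <= u i <= 1) -> (forall i, 0 <= v i <= 1) ->
  `|\prod_(i <- r) u i - \prod_(i <- r) v i| <= \sum_(i <- r) `|u i - v i|.
Proof.
move=> u01 v01; elim: r => [|i r IH]; first by rewrite !big_nil subrr normr0.
rewrite !big_cons; set U := \prod_(j <- r) u j in IH *.
set V := \prod_(j <- r) v j in IH *.
have -> : u i * U - v i * V = (u i - v i) * U + v i * (U - V) by ring.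
apply: le_trans (ler_normD _ _) _; rewrite !normrM; apply: lerD.
  rewrite ler_piMr // ger0_norm; last by apply: prodr_ge0 => j _; case/andP: (u01 j).
  by apply: prodr_ile1 => j _.
apply: le_trans IH; rewrite ler_piMl //.
by have /andP[v0 v1] := v01 i; rewrite ger0_norm.
Qed.

(** The mean of t^al over the simplex t_0 + ... + t_n = 1, t_i >= 0. *)
Definition simplex_moment n (al : 'I_n.+1 -> nat) : C :=
  (n`! * \prod_i (al i)`!)%:R / ((\sum_i al i + n)`!)%:R.

Definition simplex_mean n N (F : ('I_n.+1 -> C) -> C) : C :=
  (size (compositions n N))%:R^-1 *
  \sum_(s <- compositions n N) F (fun i => (nth 0%N s i)%:R / N%:R).

Lemma simplex_mean_monomial n (al : 'I_n.+1 -> nat) :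
  exists2 K : C, 0 <= K & forall N, (0 < N)%N ->
  `|simplex_mean N (fun t => \prod_i t i ^+ al i) - simplex_moment al| <= K / N%:R.
Proof.
pose k := (\sum_i al i)%N.
exists ((\sum_i (al i ^ 2)%N)%:R + simplex_moment al * (k ^ 2)%N%:R).
  by rewrite addr_ge0 // mulr_ge0 // divr_ge0.
move=> N N_gt0; have N0 : 0 < N%:R :> C by rewrite ltr0n.
pose cnt := size (compositions n N).
have cnt_gt0 : (0 < cnt)%N by rewrite /cnt size_compositions bin_gt0 leq_addl.
pose v (s : seq nat) (i : 'I_n.+1) := (nth 0%N s i ^_ al i)%:R / N%:R ^+ al i : C.
pose u (s : seq nat) (i : 'I_n.+1) := ((nth 0%N s i)%:R / N%:R) ^+ al i : C.
pose V := cnt%:R^-1 * \sum_(s <- compositions n N) \prod_i v s i.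
have VE : V = simplex_moment al * ((N ^_ k)%:R / N%:R ^+ k).
  (* the identity for compositions takes exponents indexed by nat *)
  pose al' i := if insub i is Some j then al j else 0%N.
  have alE (i : 'I_n.+1) : al' i = al i by rewrite /al' valK.
  have := @sum_compositions_ffact n N al'; rewrite /= -/cnt.
  under eq_bigr => s _ do under eq_bigr => i _ do rewrite alE.
  under [X in (X + n)`!]eq_bigr => i _ do rewrite alE.
  under [X in (cnt * X)%N]eq_bigr => i _ do rewrite alE.
  under [X in (_ ^_ X)%N]eq_bigr => i _ do rewrite alE.
  rewrite -/k => /(congr1 (fun m => m%:R : C)); rewrite !natrM => E.
  have -> : V = cnt%:R^-1 * ((\sum_(s <- compositions n N)
       \prod_(i < n.+1) nth 0 s i ^_ al i)%N%:R / N%:R ^+ k).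
    congr (_ * _); rewrite natr_sum mulr_suml; apply: eq_bigr => s _.
    rewrite /v big_split /= natr_prod; congr (_ * _).
    by rewrite prodfV prodrXr.
  have f0 : ((k + n)`!)%:R != 0 :> C by rewrite pnatr_eq0 -lt0n fact_gt0.
  have c0 : cnt%:R != 0 :> C by rewrite pnatr_eq0 -lt0n.
  have -> : (\sum_(s <- compositions n N) \prod_(i < n.+1) nth 0 s i ^_ al i)%N%:R =
     cnt%:R * (\prod_i (al i)`!)%:R * n`!%:R * (N ^_ k)%:R / ((k + n)`!)%:R :> C.
    by rewrite -E mulfK.
  rewrite /simplex_moment -/k natrM; field.
  by rewrite f0 c0 expf_neq0 // gt_eqF.
have sN s (i : 'I_n.+1) : s \in compositions n N -> (nth 0%N s i <= N)%N.
  by move=> /sum_nth_composition <-; rewrite (bigD1 i) //= leq_addr.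
have close1 : `|simplex_mean N (fun t => \prod_i t i ^+ al i) - V|
    <= (\sum_i (al i ^ 2)%N)%:R / N%:R.
  rewrite /simplex_mean /V -mulrBr normrM normfV normr_nat -/cnt.
  rewrite ler_pdivrMl ?ltr0n // -sumrB.
  set X := (X in _ <= _ * X).
  have -> : cnt%:R * X = \sum_(s <- compositions n N) X.
    by rewrite big_const_seq count_predT iter_addr_0 mulr_natl.
  apply: le_trans (ler_norm_sum _ _ _) _.
  rewrite [leLHS]big_seq [leRHS]big_seq; apply: ler_sum => s s_in.
  apply: le_trans (@prod_close _ _ (u s) (v s) _ _) _.
  - by move=> i; have [] := ffact_scaled_close (al i) N_gt0 (sN s i s_in).
  - by move=> i; have [] := ffact_scaled_close (al i) N_gt0 (sN s i s_in).
  rewrite /X natr_sum mulr_suml; apply: ler_sum => i _.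
  by have [] := ffact_scaled_close (al i) N_gt0 (sN s i s_in).
have close2 : `|V - simplex_moment al| <= simplex_moment al * (k ^ 2)%N%:R / N%:R.
  have mom0 : 0 <= simplex_moment al by rewrite divr_ge0.
  have -> : V - simplex_moment al = - (simplex_moment al * (1 - (N ^_ k)%:R / N%:R ^+ k)).
    by rewrite VE; ring.
  rewrite normrN normrM ger0_norm // -mulrA ler_wpM2l //.
  have [_ _] := ffact_scaled_close k N_gt0 (leqnn N).
  by rewrite divff ?gt_eqF // expr1n.
rewrite mulrDl -(subrK V (simplex_mean _ _)) -addrA.
by apply: le_trans (ler_normD _ _) _; apply: lerD.
Qed.
End SimplexMoments.

(** * Means over the unit sphere *)
Section SphereMean.
Variables (C : numClosedFieldType) (n : nat).
Implicit Types (F : ('I_n.+1 -> C) -> C) (g c : C).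

Definition torus_mean D (w : C) F : C :=
  D%:R^-1 ^+ n.+1 * \sum_(f : {ffun 'I_n.+1 -> 'I_D}) F (fun i => w ^+ f i).

Lemma torus_mean_prod D w (f : 'I_n.+1 -> C -> C) :
  torus_mean D w (fun s => \prod_i f i (s i)) = \prod_i unity_mean D w (f i).
Proof.
rewrite /torus_mean /unity_mean big_split /= prodr_const card_ord.
by rewrite (bigA_distr_bigA (fun (i : 'I_n.+1) (j : 'I_D) => f i (w ^+ j))).
Qed.

(** The uniform measure on the sphere is the image of the uniform measures on the
    simplex and the torus under (t, s) |-> (sqrt(t_i) s_i). *)
Definition sphere_mean D w N F : C :=
  simplex_mean N (fun t => torus_mean D w (fun s => F (fun i => sqrtC (t i) * s i))).

(** The number g is the mean over the sphere of F, a polynomial in z and conj(z).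
    The order D of the roots of unity only has to exceed the degree of F, for then
    the angular part of the mean is exact; the radial part has error O(1/N). *)
Definition has_sphere_mean F g := exists D0 K, 0 <= K /\
  forall D w N, D.-primitive_root w -> (D0 < D)%N -> (0 < N)%N ->
    `|sphere_mean D w N F - g| <= K / N%:R.

Lemma simplex_mean_eq N (f h : ('I_n.+1 -> C) -> C) :
  (forall t, (forall i, 0 <= t i) -> f t = h t) -> simplex_mean N f = simplex_mean N h.
Proof.
by move=> fh; congr (_ * _); apply: eq_bigr => s _; apply: fh => i; rewrite divr_ge0.
Qed.

Lemma simplex_mean_le N (f h : ('I_n.+1 -> C) -> C) : (0 < N)%N ->
  (forall t, (forall i, 0 <= t i) -> \sum_i t i = 1 -> f t <= h t) ->
  simplex_mean N f <= simplex_mean N h.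
Proof.
move=> N_gt0 fh; rewrite ler_wpM2l // [leLHS]big_seq [leRHS]big_seq.
apply: ler_sum => s s_in; apply: fh => [i|]; first by rewrite divr_ge0.
rewrite -mulr_suml -natr_sum (sum_nth_composition s_in) divff //.
by rewrite pnatr_eq0 -lt0n.
Qed.

Lemma simplex_mean_cst N c : simplex_mean N (fun _ : 'I_n.+1 -> C => c) = c.
Proof.
rewrite /simplex_mean big_const_seq count_predT iter_addr_0 -[c *+ _]mulr_natl mulrA.
by rewrite mulVf ?mul1r // size_compositions pnatr_eq0 -lt0n bin_gt0 leq_addl.
Qed.

Lemma simplex_meanZ N c (f : ('I_n.+1 -> C) -> C) :
  simplex_mean N (fun t => c * f t) = c * simplex_mean N f.
Proof. by rewrite /simplex_mean -mulr_sumr mulrCA. Qed.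

Lemma simplex_meanD N (f h : ('I_n.+1 -> C) -> C) :
  simplex_mean N (fun t => f t + h t) = simplex_mean N f + simplex_mean N h.
Proof. by rewrite /simplex_mean big_split mulrDr. Qed.

Lemma torus_meanZ D w c F : torus_mean D w (fun s => c * F s) = c * torus_mean D w F.
Proof. by rewrite /torus_mean -mulr_sumr mulrCA. Qed.

Lemma torus_meanD D w F1 F2 :
  torus_mean D w (fun s => F1 s + F2 s) = torus_mean D w F1 + torus_mean D w F2.
Proof. by rewrite /torus_mean big_split mulrDr. Qed.

Lemma sphere_meanZ D w N c F :
  sphere_mean D w N (fun z => c * F z) = c * sphere_mean D w N F.
Proof.
rewrite /sphere_mean -simplex_meanZ; apply: simplex_mean_eq => t _.
by rewrite torus_meanZ.
Qed.

Lemma sphere_meanD D w N F1 F2 :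
  sphere_mean D w N (fun z => F1 z + F2 z)
  = sphere_mean D w N F1 + sphere_mean D w N F2.
Proof.
rewrite /sphere_mean -simplex_meanD; apply: simplex_mean_eq => t _.
by rewrite torus_meanD.
Qed.

Lemma sphere_mean_conj D w N F :
  sphere_mean D w N (fun z => (F z)^*) = (sphere_mean D w N F)^*.
Proof.
rewrite /sphere_mean /simplex_mean /torus_mean !(rmorphM, rmorph_sum) fmorphV.
rewrite rmorph_nat; congr (_ * _); apply: eq_bigr => s _.
rewrite rmorphM rmorph_sum rmorphXn fmorphV rmorph_nat; congr (_ * _).
Qed.

Lemma sphere_mean_le D w N F c : D.-primitive_root w -> (0 < N)%N ->
  (forall z, \sum_i `|z i| ^+ 2 = 1 -> F z <= c) -> sphere_mean D w N F <= c.
Proof.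
move=> w_prim N_gt0 Fc; rewrite -[leRHS](simplex_mean_cst N).
apply: simplex_mean_le => // t t0 t1.
have D_gt0 := prim_order_gt0 w_prim.
rewrite /torus_mean exprVn ler_pdivrMl ?exprn_gt0 ?ltr0n //.
have -> : D%:R ^+ n.+1 * c = \sum_(f : {ffun 'I_n.+1 -> 'I_D}) c.
  by rewrite sumr_const card_ffun !card_ord -[c *+ _]mulr_natl natrX.
apply: ler_sum => f _; apply: Fc; rewrite -t1; apply: eq_bigr => i _.
rewrite normrM (norm_prim_root_exp w_prim) mulr1 ger0_norm ?sqrtC_ge0 //.
by rewrite sqrtCK.
Qed.

Lemma sphere_mean_monomial (a b : 'I_n.+1 -> nat) D w N :
  D.-primitive_root w -> (forall i, a i < D)%N -> (forall i, b i < D)%N ->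
  sphere_mean D w N (fun z => \prod_i (z i ^+ a i * (z i)^* ^+ b i))
  = [forall i, a i == b i]%:R * simplex_mean N (fun t => \prod_i t i ^+ a i).
Proof.
move=> w_prim aD bD; rewrite -simplex_meanZ; apply: simplex_mean_eq => t t0.
pose q i := sqrtC (t i).
transitivity (torus_mean D w (fun s =>
    \prod_i ((q i ^+ a i * (q i)^* ^+ b i) * (s i ^+ a i * (s i)^* ^+ b i)))).
  congr (_ * _); apply: eq_bigr => f _; apply: eq_bigr => i _.
  by rewrite rmorphM !exprMn -/(q i); ring.
rewrite (torus_mean_prod D w (fun i s =>
   (q i ^+ a i * (q i)^* ^+ b i) * (s ^+ a i * s^* ^+ b i))).
under eq_bigr => i _ do rewrite unity_meanZ unity_mean_monomial //.
have [/forallP ab | /forallPn[i /negPf abi]] := boolP [forall i, a i == b i].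
  rewrite mul1r; apply: eq_bigr => i _; rewrite (ab i) mulr1 -(eqP (ab i)).
  by rewrite -exprMn -normCK ger0_norm ?sqrtC_ge0 // sqrtCK.
by rewrite mul0r (bigD1 i) //= abi mulr0 mul0r.
Qed.

Lemma has_sphere_mean_monomial (a b : 'I_n.+1 -> nat) :
  has_sphere_mean (fun z => \prod_i (z i ^+ a i * (z i)^* ^+ b i))
    ([forall i, a i == b i]%:R * simplex_moment C a).
Proof.
have [K K0 HK] := simplex_mean_monomial C a.
exists (\sum_i (a i + b i))%N, K; split=> // D w N w_prim abD N_gt0.
have abi i : (a i + b i < D)%N.
  by apply: leq_ltn_trans abD; rewrite (bigD1 i) //= leq_addr.
rewrite sphere_mean_monomial // => [|i|i]; last 2 first.
- exact: leq_ltn_trans (leq_addr _ _) (abi i).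
- exact: leq_ltn_trans (leq_addl _ _) (abi i).
rewrite -mulrBr normrM normr_nat; apply: le_trans (HK N N_gt0).
by rewrite ler_piMl //; case: [forall i, _].
Qed.

Lemma eq_has_sphere_mean F1 F2 g :
  (forall z, F1 z = F2 z) -> has_sphere_mean F2 g -> has_sphere_mean F1 g.
Proof. by move=> /funext ->. Qed.

Lemma has_sphere_meanZ F g c :
  has_sphere_mean F g -> has_sphere_mean (fun z => c * F z) (c * g).
Proof.
move=> [D0 [K [K0 HK]]]; exists D0, (`|c| * K); split; first by rewrite mulr_ge0.
move=> D w N w_prim D_gt N_gt0.
by rewrite sphere_meanZ -mulrBr normrM -mulrA ler_wpM2l // HK.
Qed.

Lemma has_sphere_mean_sum (I : Type) (r : seq I) (F : I -> ('I_n.+1 -> C) -> C)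
    (g : I -> C) :
  (forall i, has_sphere_mean (F i) (g i)) ->
  has_sphere_mean (fun z => \sum_(i <- r) F i z) (\sum_(i <- r) g i).
Proof.
move=> HF; elim: r => [|i r [D2 [K2 [K20 HK2]]]].
  exists 0%N, 0; split=> // D w N _ _ _; rewrite big_nil subr0 mul0r.
  rewrite (_ : (fun z => _) = fun z => 0 * 0);
    last by apply/funext => z; rewrite big_nil mul0r.
  by rewrite (sphere_meanZ _ _ _ 0 (fun=> 0)) mul0r normr0.
have [D1 [K1 [K10 HK1]]] := HF i.
exists (D1 + D2)%N, (K1 + K2); split; first by rewrite addr_ge0.
move=> D w N w_prim D_gt N_gt0.
rewrite (_ : (fun z => _) = fun z => F i z + \sum_(j <- r) F j z);
  last by apply/funext => z; rewrite big_cons.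
rewrite sphere_meanD big_cons opprD addrACA mulrDl.
apply: le_trans (ler_normD _ _) _; apply: lerD; [apply: HK1|apply: HK2] => //.
- exact: leq_ltn_trans (leq_addr _ _) D_gt.
- exact: leq_ltn_trans (leq_addl _ _) D_gt.
Qed.

End SphereMean.

(** The mean over the sphere is a limit of means over points of the sphere, hence
    a positive functional. *)
Lemma has_sphere_mean_le (R : realType) n (F : ('I_n.+1 -> R[i]) -> R[i]) (g c : R[i]) :
  has_sphere_mean F g ->
  (forall z, \sum_i `|z i| ^+ 2 = 1 -> F z + (F z)^* <= c) -> g + g^* <= c.
Proof.
move=> [D0 [K [K0 HK]]] Fc.
have [w w_prim] := @exists_prim_root R[i] D0.+1 isT.
apply: (@le_of_geometric _ 2^-1 _ _ (K *+ 2)); rewrite ?mulrn_wge0 //.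
  by rewrite invr_ge0 ler0n invf_lt1 ?ltr0n ?ltr1n.
move=> l; have N_gt0 : (0 < 2 ^ l)%N by rewrite expn_gt0.
have := HK _ w (2 ^ l)%N w_prim (ltnSn _) N_gt0.
have := @sphere_mean_le _ _ _ w (2 ^ l)%N (fun z => F z + (F z)^*) c w_prim N_gt0 Fc.
rewrite sphere_meanD sphere_mean_conj natrX -exprVn.
set m := sphere_mean _ _ _ _ => mc mg.
have -> : g + g^* = (m + m^*) + ((g - m) + (g - m)^*) by rewrite rmorphB; ring.
apply: lerD => //; apply: le_trans (addC_conj_le _) _.
by rewrite distrC mulrnAl lerMn2r mg orbT.
Qed.

(** * The multiplier Gamma and the powers of A_z *)
Section GammaCoefficients.
Variables (C : fieldType) (n : nat).
Implicit Types (p q : mpoly n C) (m : multinom n).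

Definition gamma_coef m : C :=
  if mdeg m == 0%N then 1 else 2 * \prod_(1 <= j < n) (j%:R + (mdeg m)%:R).

Lemma mcoeff_sum_monomials p (f : multinom n -> C) m :
  mcoeff m (\sum_(k <- msupp p) (f k * mcoeff k p) *: mpolyX C k) = f m * mcoeff m p.
Proof.
rewrite linear_sum /=; under eq_bigr => k _ do rewrite linearZ /= mcoeffX.
have [m_in|m_out] := boolP (m \in msupp p).
  rewrite (bigD1_seq m) //= eqxx mulr1 big1 ?addr0 // => k /negPf ->.
  by rewrite mulr0.
rewrite memN_msupp_eq0 // mulr0 big_seq big1 // => k k_in.
case: eqP => [km|]; last by rewrite mulr0.
by rewrite km (negPf m_out) in k_in.
Qed.

(** Euler's identity: monomials are eigenvectors of the Euler operator, so Ez and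
    Gamma act on coefficients by multipliers that depend on the degree only. *)
Lemma eulerX m : euler (mpolyX C m) = (mdeg m)%:R *: mpolyX C m.
Proof.
rewrite mdegE natr_sum scaler_suml; apply: eq_bigr => i _.
rewrite mderivX -scalerAr -mpolyXD.
have [->|mi] := eqVneq (m i) 0%N; first by rewrite !scale0r.
congr (_ *: mpolyX C _); apply/mnmP => j.
rewrite mnmDE mnmBE mnm1E; case: eqP => [<-|_]; last by rewrite subn0.
by rewrite subnKC // lt0n.
Qed.

Lemma mcoeff_euler q m : mcoeff m (euler q) = (mdeg m)%:R * mcoeff m q.
Proof.
have eulerE : euler q = \sum_(k <- msupp q) ((mdeg k)%:R * mcoeff k q) *: mpolyX C k.
  rewrite {1}[q]mpolyE /euler.
  under eq_bigr => i _ do rewrite linear_sum mulr_sumr.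
  rewrite exchange_big; apply: eq_bigr => k _ /=.
  rewrite mulrC -scalerA -eulerX scaler_sumr; apply: eq_bigr => i _.
  by rewrite linearZ /= scalerAr.
by rewrite eulerE mcoeff_sum_monomials.
Qed.

Lemma mcoeff_Ez q m :
  mcoeff m (Ez q) = ((n.-1)`!)%:R^-1 * \prod_(1 <= j < n) (j%:R + (mdeg m)%:R) * mcoeff m q.
Proof.
rewrite /Ez linearZ /= -mulrA; congr (_ * _).
rewrite /index_iota; elim: (iota _ _) q => [|j s IH] q.
  by rewrite !big_nil mul1r.
rewrite !big_cons /= linearD linearZ /= mcoeff_euler -mulrDl IH; ring.
Qed.

Lemma meval0_mcoeff p : meval (fun=> 0) p = mcoeff (@mnm0 n) p.
Proof.
rewrite {1}[p]mpolyE -[RHS]mul1r -(mcoeff_sum_monomials p (fun=> 1)).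
rewrite [LHS]rmorph_sum [RHS]linear_sum; apply: eq_bigr => m _.
rewrite /= mul1r mevalZ linearZ /= mevalX mcoeffX; congr (_ * _).
have [->|m_neq0] := eqVneq m (@mnm0 n); first by rewrite big1 // => i _; rewrite mnm0E expr0.
have [i mi] : exists i, m i != 0%N.
  apply/existsP; apply: contraNT m_neq0 => /existsPn m0.
  by apply/eqP/mnmP => i; rewrite mnm0E; apply/eqP; rewrite -[_ == _]negbK.
by rewrite (bigD1 i) //= expr0n (negPf mi) mul0r.
Qed.

Lemma mcoeff_Gamma p m : (n.-1)`!%:R != 0 :> C ->
  mcoeff m (Gamma p) = gamma_coef m * mcoeff m p.
Proof.
move=> f0; rewrite /Gamma /const_part linearD linearZ /= mcoeff_Ez linearB /=.
rewrite meval0_mcoeff mcoeffC /gamma_coef mdeg_eq0.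
have [->|_] := eqVneq m (@mnm0 n).
  by rewrite mulr1 subrr !mulr0 add0r mul1r.
by rewrite mulr0 subr0 addr0; field.
Qed.

Lemma meval_Gamma p v : (n.-1)`!%:R != 0 :> C ->
  meval v (Gamma p)
  = \sum_(m <- msupp p) gamma_coef m * mcoeff m p * \prod_i v i ^+ m i.
Proof.
move=> f0.
have -> : Gamma p = \sum_(m <- msupp p) (gamma_coef m * mcoeff m p) *: mpolyX C m.
  by apply/mpolyP => m; rewrite mcoeff_Gamma // mcoeff_sum_monomials.
by rewrite rmorph_sum; apply: eq_bigr => m _; rewrite /= mevalZ mevalX.
Qed.
End GammaCoefficients.

Section Words.
Variables (C : numClosedFieldType) (H : lmodType C) (n : nat).
Variable T : 'I_n -> {linear H -> H}.

Definition conj_combination (z : 'I_n -> C) (x : H) : H := \sum_i (z i)^* *: T i x.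

Lemma conj_combination_linear z : linear (conj_combination z).
Proof.
move=> a x y; rewrite /conj_combination scaler_sumr -big_split; apply: eq_bigr => i _.
by rewrite linearP scalerDr !scalerA mulrC.
Qed.
HB.instance Definition _ z :=
  GRing.isLinear.Build C H H *:%R (conj_combination z) (conj_combination_linear z).

Lemma big_tuple_cons (V : nmodType) (I : finType) k (F : seq I -> V) :
  \sum_(w : k.+1.-tuple I) F w = \sum_(i : I) \sum_(w : k.-tuple I) F (i :: w).
Proof.
rewrite pair_big /= (reindex (fun p : I * k.-tuple I => [tuple of p.1 :: p.2])) //=.
exists (fun w => (thead w, behead_tuple w)) => [[i w] _|w _].
  by congr (_, _); apply: val_inj.
by rewrite [w in RHS]tuple_eta.
Qed.

Lemma iter_conj_combination z k x :
  iter k (conj_combination z) x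
  = \sum_(w : k.-tuple 'I_n) (\prod_(i <- w) (z i)^*) *: word_op T w x.
Proof.
elim: k => [|k IH].
  rewrite (big_pred1 [tuple]) => [|w]; last by rewrite [w]tuple0 /= [RHS]eqxx.
  by rewrite big_nil scale1r.
rewrite iterS IH (big_tuple_cons _ (fun w => (\prod_(i <- w) (z i)^*) *: word_op T w x)).
apply: eq_bigr => i _; rewrite linear_sum scaler_sumr; apply: eq_bigr => w _.
by rewrite linearZ scalerA big_cons.
Qed.

Lemma prod_count (z : 'I_n -> C) (w : seq 'I_n) :
  \prod_(i <- w) z i = \prod_i z i ^+ count_mem i w.
Proof.
elim: w => [|j w IH]; first by rewrite big_nil big1.
rewrite big_cons IH (bigD1 j) //= [RHS](bigD1 j) //= eqxx exprS mulrA.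
congr (_ * _); apply: eq_bigr => i /negPf; by rewrite eq_sym => ->.
Qed.
End Words.

(** * Norms of tuples of vectors *)
Section Norms.
Variable R : realType.

Lemma rnormE (V : normedZmodType R[i]) (x : V) : (rnorm x)%:C%C = `|x|.
Proof. exact/RRe_real/normr_real. Qed.

Lemma rnorm_ge0 (V : normedZmodType R[i]) (x : V) : 0 <= rnorm x.
Proof. rewrite -lecR rnormE; exact: normr_ge0. Qed.

Lemma l2norm_ge0 (V : normedZmodType R[i]) d (x : 'cV[V]_d) : 0 <= l2norm x.
Proof. exact: sqrtr_ge0. Qed.

Lemma l2norm_sqr (V : normedZmodType R[i]) d (x : 'cV[V]_d) :
  (l2norm x ^+ 2)%:C%C = \sum_i `|x i 0| ^+ 2.
Proof.
rewrite sqr_sqrtr; last by apply: sumr_ge0 => i _; rewrite sqr_ge0.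
by rewrite rmorph_sum; apply: eq_bigr => i _; rewrite rmorphXn /= rnormE.
Qed.

Lemma l2norm_le (V : normedZmodType R[i]) d (x : 'cV[V]_d) (W : normedZmodType R[i])
    e (y : 'cV[W]_e) (c : R) : 0 <= c ->
  (l2norm x <= c * l2norm y) =
  (\sum_i `|x i 0| ^+ 2 <= c%:C%C ^+ 2 * \sum_i `|y i 0| ^+ 2).
Proof.
move=> c0; rewrite -!l2norm_sqr -rmorphXn -rmorphM lecR -exprMn.
by rewrite ler_sqr // nnegrE ?mulr_ge0 ?l2norm_ge0.
Qed.
End Norms.

(** * The inequality for the symmetrized calculus *)
Section Core.
Variables (R : realType) (H : normedModType R[i]) (ip : {dot H for Num.conj}).
Variables (n : nat) (T : 'I_n.+1 -> {linear H -> H}).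
Hypothesis ip_norm : forall x : H, `|x| ^+ 2 = ip x x.
Hypothesis WT : joint_numerical_range_in_ball ip T.

Lemma conj_combination_numerical_radius (z : 'I_n.+1 -> R[i]) (u : H) :
  \sum_i `|z i| ^+ 2 = 1 -> `|ip (conj_combination T z u) u| <= ip u u.
Proof.
move=> z1; have [->|u0] := eqVneq u 0.
  by rewrite linear0 linear0l normr0.
pose v := `|u|^-1 *: u.
have u0' : `|u| != 0 by rewrite normr_eq0.
have v1 : `|v| = 1 by rewrite normrZ normfV normr_id mulVf.
have ball : closed_unit_ball (\col_i z i).
  rewrite /closed_unit_ball /= -(expr_le1 (n := 2)) ?l2norm_ge0 //.
  rewrite -lecR l2norm_sqr; under eq_bigr do rewrite mxE.
  by rewrite z1.
have /(_ (ip (conj_combination T z v) v)) := WT ball.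
have -> : (fun x : H => \sum_i ((\col_i z i) i 0)^* *: T i x) = conj_combination T z.
  by apply/funext => x; apply: eq_bigr => i _; rewrite mxE.
move=> /(_ (ex_intro2 _ _ v v1 erefl)) /=.
have uV0 : 0 <= `|u|^-1 by rewrite invr_ge0.
rewrite /v [conj_combination T z _]linearZ ipZl ipZr (geC0_conj uV0).
rewrite mulrA -invfM -expr2 normrM.
rewrite ger0_norm ?invr_ge0 ?exprn_ge0 // ip_norm ler_pdivrMl ?mulr1 //.
by rewrite dnorm_gt0.
Qed.

(** The multiplier of 2 E_z[P - P(0)] + P(0), that is, of Gamma without its
    factor (n-1)!; here there are n.+1 variables. *)
Definition symbol_coef (m : multinom n.+1) : R[i] :=
  if mdeg m == 0%N then 1
  else 2 * \prod_(1 <= j < n.+1) (j%:R + (mdeg m)%:R) / n`!%:R.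

Lemma fact_addn a b : ((a + b)`! = a`! * \prod_(1 <= j < b.+1) (j + a))%N.
Proof.
elim: b => [|b IH]; first by rewrite addn0 big_geq // muln1.
rewrite addnS factS IH [in RHS]big_nat_recr //=.
by rewrite mulnC -mulnA addSn [(b + a)%N]addnC.
Qed.

(** The multiplier cancels the moments of the sphere: what remains is twice the
    coefficient a!/|a|! of the symmetrized monomial. *)
Lemma symbol_coef_moment (m : multinom n.+1) :
  symbol_coef m * ((mdeg m == 0%N)%:R + 1) * simplex_moment R[i] m
  = 2 * ((\prod_i (m i)`!)%:R / (mdeg m)`!%:R).
Proof.
rewrite /symbol_coef /simplex_moment -mdegE.
have f0 k : k`!%:R != 0 :> R[i] by rewrite pnatr_eq0 -lt0n fact_gt0.
have [m0|m0] := eqVneq (mdeg m) 0%N.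
  by rewrite m0 fact0 add0n natrM /=; field; rewrite f0.
rewrite add0r mulr1.
rewrite fact_addn.
rewrite !natrM !natr_prod.
have -> : \prod_(1 <= j < n.+1) (j + mdeg m)%N%:R
    = \prod_(1 <= j < n.+1) (j%:R + (mdeg m)%:R) :> R[i].
  by apply: eq_bigr => j _; rewrite natrD.
have p0 : \prod_(1 <= j < n.+1) (j%:R + (mdeg m)%:R) != 0 :> R[i].
  rewrite prodf_seq_neq0; apply/allP => j _ /=.
  by rewrite -natrD pnatr_eq0 addn_eq0 negb_and m0 orbT.
by field; rewrite p0 !f0.
Qed.

(** The homogeneous part of degree k of 2 E_z[P - P(0)] + P(0), at z. *)
Definition symbol_part d (P : 'M[mpoly n.+1 R[i]]_d) (z : 'I_n.+1 -> R[i]) k : 'M[R[i]]_d :=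
  \matrix_(i, j) \sum_(m <- msupp (P i j) | mdeg m == k)
     symbol_coef m * mcoeff m (P i j) * \prod_l z l ^+ m l.

Definition mx_mdeg_bound d (P : 'M[mpoly n.+1 R[i]]_d) : nat :=
  \max_i \max_j msize (P i j).

Lemma mdeg_lt_bound d (P : 'M[mpoly n.+1 R[i]]_d) i j m :
  m \in msupp (P i j) -> (mdeg m < mx_mdeg_bound P)%N.
Proof.
move=> /msize_mdeg_lt /leq_trans; apply.
apply: leq_trans (leq_bigmax i); exact: (leq_bigmax (F := fun j => msize (P i j))).
Qed.

Lemma sum_by_degree d (P : 'M[mpoly n.+1 R[i]]_d) i j (f : multinom n.+1 -> R[i]) :
  \sum_(k < mx_mdeg_bound P) \sum_(m <- msupp (P i j) | mdeg m == k) f m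
  = \sum_(m <- msupp (P i j)) f m.
Proof.
under eq_bigr => k _ do rewrite big_mkcond.
rewrite exchange_big [LHS]big_seq [RHS]big_seq; apply: eq_bigr => m m_in.
rewrite -big_mkcond /= (big_pred1 (Ordinal (mdeg_lt_bound m_in))) //.
Qed.

Lemma prod_scale (s : R[i]) (z : 'I_n.+1 -> R[i]) (m : multinom n.+1) :
  \prod_l (s * z l) ^+ m l = s ^+ mdeg m * \prod_l z l ^+ m l.
Proof.
rewrite mdegE -prodrXr -big_split; apply: eq_bigr => l _; exact: exprMn.
Qed.

(** At s z, the symbol is a convex combination of Gamma P at s z and at 0: in
    positive degree the value at 0 vanishes, and in degree 0 both multipliers
    are 1. *)
Lemma sum_symbol_part d (P : 'M[mpoly n.+1 R[i]]_d) z s i j :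
  (\sum_(k < mx_mdeg_bound P) s ^+ k *: symbol_part P z k) i j
  = n`!%:R^-1 * meval (fun l => s * z l) (Gamma (P i j))
    + (1 - n`!%:R^-1) * meval (fun=> 0) (Gamma (P i j)).
Proof.
have f0 : n`!%:R != 0 :> R[i] by rewrite pnatr_eq0 -lt0n fact_gt0.
rewrite !meval_Gamma // !mulr_sumr -big_split /= summxE.
rewrite -[RHS]sum_by_degree; apply: eq_bigr => k _.
rewrite !mxE mulr_sumr; apply: eq_bigr => m /eqP mk.
rewrite prod_scale mk /symbol_coef /gamma_coef mk.
have [k0|k0] := eqVneq (k : nat) 0%N; last first.
  have [l ml] : exists l, m l != 0%N.
    apply/existsP; apply: contraNT k0 => /existsPn m0.
    by rewrite -mk mdegE big1 // => l _; apply/eqP; rewrite -[_ == _]negbK.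
  rewrite [X in _ + _ * (_ * X)](bigD1 l) //= expr0n (negPf ml) mul0r.
  by field.
have m0 l : m l = 0%N.
  by apply/eqP; rewrite -leqn0 -k0 -mk mdegE (bigD1 l) //= leq_addr.
rewrite k0 expr0 !big1; first by field.
- by move=> l _; rewrite m0.
- by move=> l _; rewrite m0.
Qed.

Lemma sqr_norm_convex (l a b : R[i]) : 0 <= l <= 1 ->
  `|l * a + (1 - l) * b| ^+ 2 <= l * `|a| ^+ 2 + (1 - l) * `|b| ^+ 2.
Proof.
move=> /andP[l0 l1]; have l1' : 0 <= 1 - l by rewrite subr_ge0.
apply: (@le_trans _ _ ((l * `|a| + (1 - l) * `|b|) ^+ 2)).
  rewrite ler_sqr ?nnegrE ?addr_ge0 ?mulr_ge0 //.
  by apply: le_trans (ler_normD _ _) _; rewrite !normrM (ger0_norm l0) (ger0_norm l1').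
rewrite -subr_ge0.
rewrite (_ : _ - _ = l * (1 - l) * (`|a| - `|b|) ^+ 2); last by ring.
apply: mulr_ge0; first exact: mulr_ge0.
by rewrite real_exprn_even_ge0 // rpredB ?normr_real.
Qed.

(** The bound on Gamma P over the ball passes to convex combinations of its
    values, hence to the symbol on the circle through z. *)
Lemma symbol_part_contraction d (P : 'M[mpoly n.+1 R[i]]_d) (c : R) : 0 < c ->
  (forall z : 'cV[R[i]]_n.+1, closed_unit_ball z -> forall v : 'cV[R[i]]_d,
     l2norm (map_mx (meval (fun i => z i 0)) (map_mx (@Gamma _ n.+1) P) *m v)
     <= c * l2norm v) ->
  forall z, \sum_i `|z i| ^+ 2 = 1 -> forall s (v : 'cV[R[i]]_d), `|s| = 1 ->
    \sum_i `|((\sum_(k < mx_mdeg_bound P) s ^+ k *: symbol_part P z k) *m v) i 0| ^+ 2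
    <= c%:C%C ^+ 2 * \sum_i `|v i 0| ^+ 2.
Proof.
move=> c_gt0 Gc z z1 s v s1.
pose G (u : 'I_n.+1 -> R[i]) := map_mx (meval u) (map_mx (@Gamma _ n.+1) P).
have GcC u : \sum_l `|u l| ^+ 2 <= 1 ->
    \sum_i `|(G u *m v) i 0| ^+ 2 <= c%:C%C ^+ 2 * \sum_i `|v i 0| ^+ 2.
  move=> u1; rewrite -l2norm_le ?(ltW c_gt0) //.
  have -> : G u = map_mx (meval (fun l => (\col_l u l) l 0)) (map_mx (@Gamma _ n.+1) P).
    by apply/matrixP => i j; rewrite !mxE; apply: meval_eq => l; rewrite mxE.
  apply: Gc; rewrite /closed_unit_ball /= -(expr_le1 (n := 2)) ?l2norm_ge0 //.
  by rewrite -lecR l2norm_sqr; under eq_bigr do rewrite mxE.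
pose lam : R[i] := n`!%:R^-1.
have lam01 : 0 <= lam <= 1.
  by rewrite /lam invr_ge0 ler0n invf_le1 ?ltr0n ?ler1n ?fact_gt0.
have /andP[lam0 lam1] := lam01.
apply: (@le_trans _ _ (lam * \sum_i `|(G (fun l => s * z l)%R *m v) i 0| ^+ 2
   + (1 - lam) * \sum_i `|(G (fun=> 0) *m v) i 0| ^+ 2)).
  rewrite !mulr_sumr -big_split /=; apply: ler_sum => i _.
  apply: le_trans (sqr_norm_convex _ _ lam01).
  rewrite le_eqVlt; apply/orP; left; apply/eqP; congr (`|_| ^+ 2).
  rewrite !mxE !mulr_sumr -big_split; apply: eq_bigr => j _ /=.
  by rewrite sum_symbol_part !mxE -/lam; ring.
set B := c%:C%C ^+ 2 * _ in GcC *.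
rewrite (_ : B = lam * B + (1 - lam) * B); last by ring.
apply: lerD; apply: ler_wpM2l; rewrite ?subr_ge0 //; apply: GcC.
  by under eq_bigr do rewrite normrM s1 mul1r; rewrite z1.
by rewrite big1 ?ler01 // => l _; rewrite normr0 expr0n.
Qed.

(** Expanding A_z^k over the words of length k, orthogonality selects the words
    that are arrangements of the exponent m, and these sum to the symmetrized
    monomial. *)
Lemma has_sphere_mean_symbol_form d (P : 'M[mpoly n.+1 R[i]]_d) (x z : 'I_d -> H) :
  has_sphere_mean (fun zeta =>
    caratheodory_form ip (conj_combination T zeta) (mx_mdeg_bound P)
      (symbol_part P zeta) 1 x z)
  (2 * \sum_i ip (\sum_j sym_calc T (P i j) (x j)) (z i)).
Proof.
pose h (m : multinom n.+1) : R[i] := symbol_coef m * ((mdeg m == 0%N)%:R + 1).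
apply: (@eq_has_sphere_mean _ _ _ (fun zeta => \sum_i \sum_j
   \sum_(m <- msupp (P i j)) \sum_(w : (mdeg m).-tuple 'I_n.+1)
     (h m * mcoeff m (P i j) * ip (word_op T w (x j)) (z i)) *
     \prod_l (zeta l ^+ m l * (zeta l)^* ^+ count_mem l w))).
  move=> zeta; rewrite /caratheodory_form; apply: eq_bigr => i _; apply: eq_bigr => j _.
  rewrite -(sum_by_degree _ _ _ (fun m => \sum_(w : _.-tuple _) _)).
  apply: eq_bigr => k _; rewrite mxE expr1n mulr1 !mulr_suml.
  apply: eq_bigr => m /eqP mk; rewrite -mk iter_conj_combination.
  rewrite (sip_suml (dot_sip ip)) mulr_sumr; apply: eq_bigr => w _.
  rewrite (prod_count (fun l => (zeta l)^*)) big_split /= /h; ring.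
have -> : 2 * \sum_i ip (\sum_j sym_calc T (P i j) (x j)) (z i) =
   \sum_i \sum_j \sum_(m <- msupp (P i j)) \sum_(w : (mdeg m).-tuple 'I_n.+1)
     (h m * mcoeff m (P i j) * ip (word_op T w (x j)) (z i)) *
     ([forall l, m l == count_mem l w]%:R * simplex_moment R[i] m).
  rewrite mulr_sumr; apply: eq_bigr => i _.
  rewrite linear_sumlz /= mulr_sumr; apply: eq_bigr => j _.
  rewrite /sym_calc (sip_suml (dot_sip ip)) mulr_sumr; apply: eq_bigr => m _.
  rewrite /sym_monomial ipZl.
  rewrite linear_sumlz /= !mulr_sumr [LHS]big_mkcond; apply: eq_bigr => w _.
  have -> : [forall l, m l == count_mem l w] = is_arrangement m w.
    by apply: eq_forallb => l; rewrite eq_sym.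
  case: (is_arrangement m w); last by rewrite mul0r mulr0.
  rewrite mul1r; transitivity (2 * ((\prod_i0 (m i0)`!)%:R / (mdeg m)`!%:R) *
     mcoeff m (P i j) * ip (word_op T w (x j)) (z i)); first by ring.
  rewrite -symbol_coef_moment /h; ring.
do 4![apply: has_sphere_mean_sum => ?].
by apply: has_sphere_meanZ; apply: has_sphere_mean_monomial.
Qed.

(** The mean of the pointwise inequality bounds Re <P_s(T) x, z>; it is used at
    z = P_s(T) x / c, the vector for which it gives the norm of P_s(T) x. *)
Lemma l2norm_sym_calc_mx_le d (P : 'M[mpoly n.+1 R[i]]_d) (c : R) : 0 < c ->
  (forall z : 'cV[R[i]]_n.+1, closed_unit_ball z -> forall v : 'cV[R[i]]_d,
     l2norm (map_mx (meval (fun i => z i 0)) (map_mx (@Gamma _ n.+1) P) *m v)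
     <= c * l2norm v) ->
  forall x : 'cV[H]_d, l2norm (sym_calc_mx T P x) <= c * l2norm x.
Proof.
move=> c_gt0 Gc x; rewrite l2norm_le ?(ltW c_gt0) //.
pose C : R[i] := c%:C%C; rewrite -/C.
have C_gt0 : 0 < C by rewrite -(rmorph0 (real_complex R)) ltcR.
have C_neq0 : C != 0 by rewrite gt_eqF.
pose y := sym_calc_mx T P x.
have yE i : y i 0 = \sum_j sym_calc T (P i j) (x j 0) by rewrite mxE.
have := has_sphere_mean_le (c := C * (\sum_i ip (x i 0) (x i 0)
     + \sum_i ip (C^-1 *: y i 0) (C^-1 *: y i 0)) *+ 2)
  (@has_sphere_mean_symbol_form d P (fun i => x i 0) (fun i => C^-1 *: y i 0)).
move=> /(_ _)/wrap[] => [zeta zeta1|].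
  apply: caratheodory_form_le => //.
    by move=> u; apply: conj_combination_numerical_radius.
  by move=> s v s1; apply: symbol_part_contraction.
have CV : (C^-1)^* = C^-1 by rewrite geC0_conj // invr_ge0 ltW.
set Y := \sum_i ip (y i 0) (y i 0).
have Y0 : 0 <= Y by apply: sumr_ge0 => i _; apply: dnorm_ge0.
have -> : \sum_i ip (\sum_j sym_calc T (P i j) (x j 0)) (C^-1 *: y i 0) = C^-1 * Y.
  by rewrite mulr_sumr; apply: eq_bigr => i _; rewrite -yE ipZr CV.
have -> : \sum_i ip (C^-1 *: y i 0) (C^-1 *: y i 0) = C^-1 ^+ 2 * Y.
  by rewrite mulr_sumr; apply: eq_bigr => i _; rewrite ipZl ipZr CV mulrA.
rewrite (@geC0_conj _ (2 * _)); last by rewrite mulr_ge0 // mulr_ge0 // invr_ge0 ltW.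
set X := \sum_i ip (x i 0) (x i 0) => XY.
under eq_bigr do rewrite ip_norm; under [X in _ <= _ * X]eq_bigr do rewrite ip_norm.
rewrite -/Y -/X -subr_ge0.
have : 0 <= (C / 2) * (C * (X + C^-1 ^+ 2 * Y) *+ 2 - (2 * (C^-1 * Y) + 2 * (C^-1 * Y))).
  by rewrite mulr_ge0 ?subr_ge0 // divr_ge0 // ltW.
rewrite (_ : C / 2 * _ = C ^+ 2 * X - Y) //; by field.
Qed.
End Core.

(** * Operator norms and suprema *)
Section OperatorNorms.
Variable R : realType.

Lemma l2normZ (V : normedModType R[i]) d (a : R) (x : 'cV[V]_d) :
  0 <= a -> l2norm (map_mx (fun v => a%:C%C *: v) x) = a * l2norm x.
Proof.
move=> a0; apply/eqP; rewrite -(eqrXn2 (n := 2)) ?mulr_ge0 ?l2norm_ge0 //.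
rewrite exprMn -(inj_eq (@complexI _)) [X in _ == X]rmorphM /= !l2norm_sqr rmorphXn mulr_sumr.
apply/eqP; apply: eq_bigr => i _; rewrite mxE normrZ exprMn ger0_norm //.
by rewrite -(rmorph0 (real_complex R)) lecR.
Qed.

Lemma l2norm0 (V : normedZmodType R[i]) d : l2norm (0 : 'cV[V]_d) = 0.
Proof.
rewrite /l2norm big1 ?sqrtr0 // => i _.
by rewrite mxE /rnorm normr0 /= expr0n.
Qed.

(** The operator norm only sees the unit ball; homogeneity gives the rest, except
    when the norm of v is 0, where v = 0. *)
Lemma ler_opnorm d (M : 'M[R[i]]_d) (c : R) :
  (opnorm (@l2norm R R[i] d) (mulmx M) <= c%:E)%E ->
  forall v, l2norm (M *m v) <= c * l2norm v.
Proof.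
move=> Mc v; have [v0|v0] := eqVneq (l2norm v) 0.
  suff -> : v = 0 by rewrite mulmx0 l2norm0 mulr0.
  have := l2norm_sqr v; rewrite v0 expr0n /= => /esym/eqP.
  rewrite psumr_eq0 => [/allP v_eq0|i _]; last by rewrite exprn_ge0.
  apply/matrixP => i j; rewrite ord1 mxE; apply/eqP.
  by have := v_eq0 i (mem_index_enum _); rewrite expf_eq0 /= normr_eq0.
have v_gt0 : 0 < l2norm v by rewrite lt_def v0 l2norm_ge0.
pose a := (l2norm v)^-1; have a0 : 0 <= a by rewrite invr_ge0 l2norm_ge0.
have scaleE k (u : 'cV[R[i]]_k) :
    (a%:C%C *: u) = map_mx (fun t : (R[i])^o => a%:C%C *: t) u.
  by apply/matrixP => i j; rewrite !mxE.
have : ((l2norm (M *m (a%:C%C *: v)))%:E <= c%:E)%E.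
  apply: le_trans Mc; apply: ereal_sup_ubound; exists (a%:C%C *: v) => //=.
  by rewrite scaleE (@l2normZ (R[i])^o) // /a mulVf.
rewrite lee_fin -scalemxAr scaleE (@l2normZ (R[i])^o) //.
by rewrite /a ler_pdivrMl // mulrC.
Qed.

Lemma zero_in_ball n : closed_unit_ball (0 : 'cV[R[i]]_n).
Proof. by rewrite /closed_unit_ball /= l2norm0 ler01. Qed.
End OperatorNorms.

Theorem theorem9p8 (R : realType) (H : completeNormedModType R[i])
    (ip : {dot H for Num.conj}) (n : nat) (T : 'I_n -> {linear H -> H})
    (ip_norm : forall x : H, `|x| ^+ 2 = ip x x)
    (n_gt0 : (0 < n)%N)
    (T_bounded : forall i, bounded_near (T i) (nbhs (0 : H)))
    (WT : joint_numerical_range_in_ball ip T) :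
  (forall p : mpoly n R[i],
     (opnorm (@rnorm R H) (sym_calc T p) <= supnorm (Gamma p))%E) /\
  (forall (d : nat) (P : 'M[mpoly n R[i]]_d),
     (opnorm (@l2norm R H d) (sym_calc_mx T P)
        <= supnorm_mx (map_mx (@Gamma _ n) P))%E).
Proof.
case: n n_gt0 T T_bounded WT => [//|n] _ T _ WT.
have core := l2norm_sym_calc_mx_le ip_norm WT.
(* Work with real bounds c > 0 only: the supremum may be infinite, and the
   one-variable argument divides by c. *)
have le_all (a : R) (b : \bar R) : (0 <= b)%E ->
    (forall c : R, 0 < c -> (b <= c%:E)%E -> a <= c) -> (a%:E <= b)%E.
  case: b => [b|_ _|//]; last exact: leey.
  rewrite lee_fin => b0 ab; rewrite lee_fin; apply/ler_addgt0Pr => e e0.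
  by apply: ab; rewrite ?lee_fin ?lerDl ?(ltW e0) //; exact: ltr_wpDl.
split=> [p|d P]; apply: ge_ereal_sup => _ [x /= x1 <-]; apply: le_all => [|c c_gt0 Gc].
- apply: le_trans (ereal_sup_ubound _); last by exists 0; [exact: zero_in_ball|].
  by rewrite lee_fin rnorm_ge0.
- (* a scalar polynomial is a matrix polynomial of size 1 *)
  have l2norm1 (V : normedZmodType R[i]) (u : 'cV[V]_1) : l2norm u = rnorm (u 0 0).
    by rewrite /l2norm big_ord1 sqrtr_sqr ger0_norm // rnorm_ge0.
  have := core 1%N (const_mx p) c c_gt0 _ (const_mx x).
  rewrite !l2norm1 !mxE big_ord1 !mxE => /(_ _)/wrap[] => [z z1 v|].
    rewrite !l2norm1 !mxE big_ord1 !mxE -lecR rmorphM !rnormE normrM.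
    rewrite ler_wpM2r // -rnormE lecR -lee_fin; apply: le_trans Gc.
    by apply: ereal_sup_ubound; exists z.
  by move=> /le_trans; apply; rewrite ler_piMr // ltW.
- apply: le_trans (ereal_sup_ubound _); last by exists 0; [exact: zero_in_ball|].
  apply: le_trans (ereal_sup_ubound _); last by exists 0; rewrite //= l2norm0 ler01.
  by rewrite lee_fin l2norm_ge0.
- have := core d P c c_gt0 _ x => /(_ _)/wrap[] => [z z1|].
    apply: ler_opnorm; apply: le_trans Gc.
    by apply: ereal_sup_ubound; exists z.
  by move=> /le_trans; apply; rewrite ler_piMr // ltW.
Qed.
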